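(* Let $P$ be a locally geometric poset. The Orlik–Solomon algebra $A(P)$ has a $\mathbb{Q}$-vector space basis given by (the classes of) $\{e_\alpha:\alpha\in\mathrm{nbc}(P)\}$, where $e_{\hat 0}=1$.
   Context: All posets are finite. For a poset $P$ and $x\in P$, $P_{\le x}=\{y\in P: y\le x\}$. For $T\subseteq P$, $\bigvee T$ is the set of minimal common upper bounds of $T$ and $\bigwedge T$ the set of maximal common lower bounds; $x\vee y$ and $x\wedge y$ denote the sets $\bigvee\{x,y\}$ and $\bigwedge\{x,y\}$. A lattice is a poset in which all $x\vee y$ and $x\wedge y$ are singletons. A poset with minimum $\hat 0$ is ranked if there is an order-preserving $\rho:P\to\mathbb{Z}_{\ge0}$ with $\rho(\hat 0)=0$ and $\rho(y)=\rho(x)+1$ whenever $y$ covers $x$; $\operatorname{at}(P)$ is the set of rank-one elements (atoms). A geometric lattice is a ranked lattice that is atomic (every element is a join of atoms) and semimodular ($\rho(x)+\rho(y)\ge\rho(x\vee y)+\rho(x\wedge y)$). $P$ is locally geometric if it is ranked, has a minimum $\hat 0$, and $P_{\le x}$ is a geometric lattice for every $x\in P$. For a locally geometric poset $P$, let $S=S(P)=\{(x,T): T\subseteq\operatorname{at}(P),\ x\in\bigvee T\}$, a subposet of $P\times 2^{\operatorname{at}(P)}$ with minimum $\hat 0=(\hat 0,\varnothing)$, and $I=I(P)=\{(x,T)\in S:\rho(x)=|T|\}$. Each $S_{\le\alpha}$ is a Boolean lattice. For $\alpha=(x,T)\in S$, $\operatorname{at}(\alpha)$ is the set of atoms $(a,\{a\})$,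 $a\in T$, of $S$ below $\alpha$ (identified with $T$), $|\alpha|=|T|$, and for $a\in\operatorname{at}(\alpha)$, $\alpha\setminus a$ is the unique element of $S_{\le\alpha}$ with atom set $\operatorname{at}(\alpha)\setminus\{a\}$. Joins and meets of elements of $S$ are taken in $S$. A circuit is a minimal element of $S\setminus I$; $\omega\in S$ is $\zeta$-unicircular if $\zeta$ is the unique circuit with $\zeta\le\omega$. Fix a linear order $<$ on the atoms. For elements (or sets of atoms) with disjoint atom sets $A,B$, $\operatorname{sgn}(A,B)$ is the sign of the permutation sorting the concatenation of $A$ and $B$ (each listed increasingly) into increasing order. A broken circuit is an element of the form $\zeta\setminus a$ with $\zeta$ a circuit and $a=\min\operatorname{at}(\zeta)$. $\mathrm{nbc}(P)$ is the set of $\beta\in S$ such that no broken circuit is $\le\beta$ (such $\beta$ automatically lie in $I$). $E(P)$ is the free graded-commutative $\mathbb{Q}$-algebra on generators $e_\alpha$, $\alpha\in I\setminus\{\hat 0\}$, with $\deg e_\alpha=|\alpha|$. $J(P)\subseteq E(P)$ is the ideal generated by: (i) $e_\alpha e_\beta$ when $\alpha\wedge\beta\ne\{\hat 0\}$; (ii) $e_\alpha e_\beta-\operatorname{sgn}(\alpha,\beta)\sum_{\gamma\in(\alpha\vee\beta)\cap I}e_\gamma$ when $\alpha\wedge\beta=\{\hat 0\}$; (iii) $\sum_{a\in\operatorname{at}(\zeta)}\operatorname{sgn}(a,\omega\setminus a)e_{\omega\setminus a}$ when $\omega$ is $\zeta$-unicircular. The Orlik–Solomon algebra is $A(P)=E(P)/J(P)$.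 *)

(* Defs.v *)
From HB Require Import structures.
From mathcomp Require Import all_boot all_order all_algebra.
From mathcomp Require Import fingroup perm generic_quotient ring_quotient.
From mathcomp Require finmap.
From mathcomp.multinomials Require Import monalg.
From mathcomp.classical Require Import boolp.

Set Implicit Arguments.
Unset Strict Implicit.
Unset Printing Implicit Defensive.

Import Order.TTheory GRing.Theory.
Import Order.DefaultProdOrder Order.DefaultSetSubsetOrder.

Local Open Scope ring_scope.
Local Open Scope quotient_scope.

(* All order-theoretic notions are relative to a subposet [D] of an ambient    *)
(* finite poset: they are applied to P, to the lower sets P_{<= x}, and to     *)
(* S(P) inside P x 2^P.                                                        *)
Section Posets.
Context {d : Order.disp_t} {X : finPOrderType d}.
Implicit Types (A D T : {set X}) (x y z : X) (rho : X -> nat).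

Definition minimals A : {set X} :=
  [set x in A | [forall y in A, (y <= x)%O ==> (y == x)]].

Definition maximals A : {set X} :=
  [set x in A | [forall y in A, (x <= y)%O ==> (y == x)]].

Definition joins D T : {set X} :=
  minimals [set y in D | [forall x in T, (x <= y)%O]].

Definition meets D T : {set X} :=
  maximals [set y in D | [forall x in T, (y <= x)%O]].

Definition lattice D : Prop :=
  {in D &, forall x y,
    #|joins D [set x; y]| = 1%N /\ #|meets D [set x; y]| = 1%N}.

Definition minimum D z : Prop := z \in D /\ {in D, forall y, (z <= y)%O}.

Definition covers D x y : Prop :=
  (x < y)%O /\ ~ exists2 z, z \in D & (x < z)%O && (z < y)%O.

(* On a poset with a minimum there is at most one such [rho].                  *)
Definition rank_function D rho : Prop :=
  [/\ {in D &, forall x y, (x <= y)%O -> (rho x <= rho y)%N},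
      forall z, minimum D z -> rho z = 0%N
    & {in D &, forall x y, covers D x y -> rho y = (rho x).+1}].

Definition atoms D rho : {set X} := [set x in D | rho x == 1%N].

Definition atomic D rho : Prop :=
  {in D, forall x, exists2 T : {set X}, T \subset atoms D rho & joins D T = [set x]}.

Definition semimodular D rho : Prop :=
  {in D &, forall x y j m,
    joins D [set x; y] = [set j] -> meets D [set x; y] = [set m] ->
    (rho j + rho m <= rho x + rho y)%N}.

Definition geometric_lattice D : Prop :=
  [/\ lattice D, exists z, minimum D z
    & exists rho, [/\ rank_function D rho, atomic D rho & semimodular D rho]].

End Posets.

Definition locally_geometric d (P : finBPOrderType d) : Prop :=
  (exists rho : P -> nat, rank_function [set: P] rho) /\
  (forall x : P, geometric_lattice [set y | (y <= x)%O]).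

(* The weak form of a linear order on the elements of [A]; the values of [r]   *)
(* outside [A] are irrelevant.                                                 *)
Definition linear_order_on (X : finType) (A : {set X}) (r : rel X) : Prop :=
  [/\ {in A, reflexive r}, {in A &, antisymmetric r},
      {in A & &, transitive r} & {in A &, total r}].

Section SignOfSorting.
Context {X : finType} (r : rel X).

(* When [s] has no repetition the permutation picked here is unique.           *)
Definition sort_perm (s : seq X) : 'S_(size s) :=
  odflt 1%g [pick p : 'S_(size s) |
    [tuple tnth (in_tuple s) (p i) | i < size s] == sort r s :> seq X].

Definition sgn (A B : {set X}) : rat :=
  (-1) ^+ odd_perm (sort_perm (sort r (enum A) ++ sort r (enum B))).

End SignOfSorting.

Section IndependenceData.
Context {d : Order.disp_t} {P : finBPOrderType d}.
Variables (rho : P -> nat) (r : rel P).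

(* Ordered componentwise, with minimum \bot = (\bot, set0). The atom (a, {a})  *)
(* of S is identified with a, so that at(alpha) is [alpha.2].                  *)
Local Notation pairs := (P * {set P})%type.
Implicit Types (alpha beta zeta omega : pairs).

Definition S_ : {set pairs} :=
  [set alpha : pairs | (alpha.2 \subset atoms [set: P] rho)
             & (alpha.1 \in joins [set: P] alpha.2)].

Definition I_ : {set pairs} := [set alpha in S_ | rho alpha.1 == #|alpha.2|].

(* The default value [alpha] is never used when P is locally geometric,        *)
(* [alpha] is in S and a is in at(alpha).                                      *)
Definition del alpha (a : P) : pairs :=
  odflt alpha
    [pick beta in S_ | (beta <= alpha)%O && (beta.2 == alpha.2 :\ a)].

Definition circuits : {set pairs} := minimals (S_ :\: I_).

Definition unicircular zeta omega : bool :=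
  [&& omega \in S_, zeta \in circuits, (zeta <= omega)%O &
      [forall zeta' in circuits, (zeta' <= omega)%O ==> (zeta' == zeta)]].

Definition broken_circuits : {set pairs} :=
  [set beta | [exists zeta in circuits, exists a in zeta.2,
     [forall b in zeta.2, r a b] && (beta == del zeta a)]].

Definition nbc : {set pairs} :=
  [set beta in S_ | [forall gamma in broken_circuits, ~~ (gamma <= beta)%O]].

End IndependenceData.

(* A / (G) may be zero, whereas the library's [algType] requires 1 != 0: it is *)
(* equipped with its [pzRingType] and [lmodType] structures only.              *)
Section PresentedQuotient.
Context {R : comPzRingType} {A : algType R}.
Variable G : A -> Prop.

Definition two_sided_ideal (K : A -> Prop) : Prop :=
  [/\ K 0, forall x y, K x -> K y -> K (x + y)
    & forall a x b, K x -> K (a * x * b)].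

Definition ideal_gen : {pred A} := fun x =>
  `[< forall K : A -> Prop,
        two_sided_ideal K -> (forall g, G g -> K g) -> K x >].

Lemma in_ideal_gen x : reflect
  (forall K, two_sided_ideal K -> (forall g, G g -> K g) -> K x)
  (x \in ideal_gen).
Proof. exact: asboolP. Qed.

Lemma ideal_genP : two_sided_ideal (fun x => x \in ideal_gen).
Proof.
split.
- by apply/in_ideal_gen => K [].
- move=> x y hx hy; apply/in_ideal_gen => K hK hG.
  by case: (hK) => _ KD _; apply: KD; [exact: (elimT (in_ideal_gen x) hx) | exact: (elimT (in_ideal_gen y) hy)].
- move=> a x b hx; apply/in_ideal_gen => K hK hG.
  by case: (hK) => _ _ KM; apply: KM; exact: (elimT (in_ideal_gen x) hx).
Qed.

Lemma ideal_genM a x b : x \in ideal_gen -> a * x * b \in ideal_gen.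
Proof. by case: ideal_genP => _ _; apply. Qed.

Lemma ideal_genMl a x : x \in ideal_gen -> a * x \in ideal_gen.
Proof. by move=> /(ideal_genM a 1); rewrite mulr1. Qed.

Lemma ideal_genMr b x : x \in ideal_gen -> x * b \in ideal_gen.
Proof. by move=> /(ideal_genM 1 b); rewrite mul1r. Qed.

Lemma ideal_genZ c x : x \in ideal_gen -> c *: x \in ideal_gen.
Proof. by move=> /(ideal_genMl (c *: 1)); rewrite -scalerAl mul1r. Qed.

Fact ideal_gen_zmod_closed : zmod_closed ideal_gen.
Proof.
have [I0 ID _] := ideal_genP; split=> // x y hx hy.
by apply: ID => //; rewrite -mulN1r; apply: ideal_genMl.
Qed.

HB.instance Definition _ :=
  GRing.isZmodClosed.Build A ideal_gen ideal_gen_zmod_closed.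

(* The quotient of [A] by the two-sided ideal generated by [G].                *)
Definition quot_alg : Type := {ideal_quot ideal_gen}.
HB.instance Definition _ := Choice.on quot_alg.
HB.instance Definition _ := EqQuotient.on quot_alg.
HB.instance Definition _ := GRing.Zmodule.on quot_alg.

Definition qclass (x : A) : quot_alg := \pi_quot_alg x.

Lemma qclass_eq x y : (qclass x == qclass y) = (x - y \in ideal_gen).
Proof. by rewrite /qclass -Quotient.idealrBE. Qed.

Lemma qclass_ind (Q : quot_alg -> Prop) : (forall x, Q (qclass x)) -> forall u, Q u.
Proof. by move=> h u; rewrite -[u]reprK; apply: h. Qed.

Lemma qclassD : {morph qclass : x y / x + y}.
Proof. by move=> x y; rewrite /qclass piE. Qed.

Lemma repr_qclass x : repr (qclass x) - x \in ideal_gen.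
Proof. by rewrite -qclass_eq /qclass reprK. Qed.

Definition quot_one : quot_alg := qclass 1.
Definition quot_mul (u v : quot_alg) : quot_alg := qclass (repr u * repr v).
Definition quot_scale (c : R) (u : quot_alg) : quot_alg := qclass (c *: repr u).

Lemma qclassM_ x y : quot_mul (qclass x) (qclass y) = qclass (x * y).
Proof.
apply/eqP; rewrite qclass_eq.
rewrite (_ : _ - _ = (repr (qclass x) - x) * repr (qclass y)
                     + x * (repr (qclass y) - y)).
  by apply: rpredD; [apply: ideal_genMr | apply: ideal_genMl]; apply: repr_qclass.
by rewrite mulrBl mulrBr addrA subrK.
Qed.

Lemma qclassZ_ c x : quot_scale c (qclass x) = qclass (c *: x).
Proof. by apply/eqP; rewrite qclass_eq -scalerBr ideal_genZ ?repr_qclass. Qed.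

Fact quot_mulA : associative quot_mul.
Proof.
elim/qclass_ind=> x; elim/qclass_ind=> y; elim/qclass_ind=> z.
by rewrite !qclassM_ mulrA.
Qed.

Fact quot_mul1l : left_id quot_one quot_mul.
Proof. by elim/qclass_ind=> x; rewrite qclassM_ mul1r. Qed.

Fact quot_mul1r : right_id quot_one quot_mul.
Proof. by elim/qclass_ind=> x; rewrite qclassM_ mulr1. Qed.

Fact quot_mulDl : left_distributive quot_mul +%R.
Proof.
elim/qclass_ind=> x; elim/qclass_ind=> y; elim/qclass_ind=> z.
by rewrite -qclassD !qclassM_ mulrDl qclassD.
Qed.

Fact quot_mulDr : right_distributive quot_mul +%R.
Proof.
elim/qclass_ind=> x; elim/qclass_ind=> y; elim/qclass_ind=> z.
by rewrite -qclassD !qclassM_ mulrDr qclassD.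
Qed.

HB.instance Definition _ := GRing.Zmodule_isPzRing.Build quot_alg
  quot_mulA quot_mul1l quot_mul1r quot_mulDl quot_mulDr.

Fact quot_scaleA a b u : quot_scale a (quot_scale b u) = quot_scale (a * b) u.
Proof. by elim/qclass_ind: u => x; rewrite !qclassZ_ scalerA. Qed.

Fact quot_scale1 : left_id 1 quot_scale.
Proof. by elim/qclass_ind=> x; rewrite qclassZ_ scale1r. Qed.

Fact quot_scaleDr : right_distributive quot_scale +%R.
Proof.
move=> a; elim/qclass_ind=> x; elim/qclass_ind=> y.
by rewrite -qclassD !qclassZ_ scalerDr qclassD.
Qed.

Fact quot_scaleDl u : {morph quot_scale^~ u : a b / a + b}.
Proof. by move=> a b; elim/qclass_ind: u => x; rewrite !qclassZ_ scalerDl qclassD. Qed.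

HB.instance Definition _ := GRing.Zmodule_isLmodule.Build R quot_alg
  quot_scaleA quot_scale1 quot_scaleDr quot_scaleDl.

Fact quot_scalerAl (a : R) (u v : quot_alg) : a *: (u * v) = (a *: u) * v.
Proof.
elim/qclass_ind: u => x; elim/qclass_ind: v => y.
by rewrite /GRing.scale /GRing.mul /= !(qclassZ_, qclassM_) scalerAl.
Qed.

Fact quot_scalerAr (a : R) (u v : quot_alg) : a *: (u * v) = u * (a *: v).
Proof.
elim/qclass_ind: u => x; elim/qclass_ind: v => y.
by rewrite /GRing.scale /GRing.mul /= !(qclassZ_, qclassM_) scalerAr.
Qed.

Lemma qclass1 : qclass 1 = 1. Proof. by []. Qed.
Lemma qclassM : {morph qclass : x y / x * y}.
Proof. by move=> x y; rewrite -qclassM_. Qed.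
Lemma qclassZ c x : qclass (c *: x) = c *: qclass x.
Proof. by rewrite -qclassZ_. Qed.

Lemma qclass_eq0 x : (qclass x == 0) = (x \in ideal_gen).
Proof.
have -> : 0 = qclass 0 by rewrite /qclass piE.
by rewrite qclass_eq subr0.
Qed.

End PresentedQuotient.

Section FreeGradedCommutative.
Variables (X : choiceType) (deg : X -> nat).

Definition free_alg : Type := {malg rat[{fmonom X}]}.
HB.instance Definition _ := GRing.Lalgebra.on free_alg.

Fact free_alg_scalerAr (c : rat) (x y : free_alg) :
  c *: (x * y) = x * (c *: y).
Proof.
apply/malgP => k; rewrite mcoeffZ mcoeffMl.
rewrite (mcoeffMlw _ (finmap.fsubset_refl _) (msuppZ_le c y)) mulr_sumr.
apply: eq_bigr => k1 _; rewrite mulr_sumr; apply: eq_bigr => k2 _.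
by rewrite mcoeffZ mulrnAr mulrCA.
Qed.

HB.instance Definition _ :=
  GRing.Lalgebra_isAlgebra.Build rat free_alg free_alg_scalerAr.

Definition free_gen (i : X) : free_alg := << fmu i >>.

(* Graded commutativity of the generators implies that of all homogeneous      *)
(* elements, and over Q it gives e_i ^+ 2 = 0 for deg i odd.                   *)
Inductive gc_rel : free_alg -> Prop :=
| GCRel i j : gc_rel (free_gen i * free_gen j
                      - (-1) ^+ (deg i * deg j)%N *: (free_gen j * free_gen i)).

Definition free_gc_alg : Type := quot_alg gc_rel.
HB.instance Definition _ := GRing.PzRing.on free_gc_alg.
HB.instance Definition _ := GRing.Lmodule.on free_gc_alg.

Fact free_gc_alg_oner_neq0 : (1 : free_gc_alg) != 0.
Proof.
pose K (x : free_alg) := mcoeff (@mone {fmonom X}) x = 0.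
have K1 : ~ K 1 by apply/eqP; rewrite /K mcoeff1 eqxx oner_eq0.
rewrite -qclass1 qclass_eq0; apply/in_ideal_gen => /(_ K) H; apply/K1/H.
  split; first exact: mcoeff0.
  - by move=> x y hx hy; rewrite /K mcoeffD hx hy addr0.
  - by move=> u x v hx; rewrite /K !rmorphM /= hx mulr0 mul0r.
move=> _ [i j]; rewrite /K mcoeffB mcoeffZ.
have X0 k (u : free_alg) : mcoeff (@mone {fmonom X}) (free_gen k * u) = 0.
  by rewrite rmorphM /= mcoeffU (_ : fmu k == mone = false) ?mul0r //; apply/eqP => /(congr1 (@fmonom_val X)); rewrite fmU fm1.
by rewrite !X0 mulr0 subr0.
Qed.

HB.instance Definition _ :=
  GRing.PzSemiRing_isNonZero.Build free_gc_alg free_gc_alg_oner_neq0.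
HB.instance Definition _ := GRing.Lmodule_isLalgebra.Build rat free_gc_alg
  (@quot_scalerAl _ _ gc_rel).
HB.instance Definition _ := GRing.Lalgebra_isAlgebra.Build rat free_gc_alg
  (@quot_scalerAr _ _ gc_rel).

Definition gc_gen (i : X) : free_gc_alg := qclass gc_rel (free_gen i).

End FreeGradedCommutative.

Section OrlikSolomon.
Context {d : Order.disp_t} {P : finBPOrderType d}.
Variables (rho : P -> nat) (r : rel P).

Local Notation S_ := (S_ rho).
Local Notation I_ := (I_ rho).
Local Notation del := (del rho).

Definition os_index := {alpha : P * {set P} | alpha \in I_ :\ \bot%O}.
Definition os_deg (i : os_index) : nat := #|(val i).2|.

Definition E_ : algType rat := free_gc_alg os_deg.

(* e_0 = 1, and by convention [e_ alpha = 0] for alpha outside I, a value      *)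
(* that never matters.                                                         *)
Definition e_ (alpha : P * {set P}) : E_ :=
  if alpha == \bot%O then 1
  else if insub alpha is Some i then gc_gen os_deg i else 0.

Inductive os_rel : E_ -> Prop :=
| OSMeet alpha beta of alpha \in I_ :\ \bot%O & beta \in I_ :\ \bot%O
    & meets S_ [set alpha; beta] <> [set \bot%O] :
    os_rel (e_ alpha * e_ beta)
| OSJoin alpha beta of alpha \in I_ :\ \bot%O & beta \in I_ :\ \bot%O
    & meets S_ [set alpha; beta] = [set \bot%O] :
    os_rel (e_ alpha * e_ beta
            - sgn r alpha.2 beta.2 *:
              \sum_(gamma in joins S_ [set alpha; beta] :&: I_) e_ gamma)
| OSCircuit zeta omega of unicircular rho zeta omega :
    os_rel (\sum_(a in zeta.2)
              sgn r [set a] (del omega a).2 *: e_ (del omega a)).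

Definition orlik_solomon : Type := quot_alg os_rel.
HB.instance Definition _ := GRing.PzRing.on orlik_solomon.
HB.instance Definition _ := GRing.Lmodule.on orlik_solomon.

Definition os_class : E_ -> orlik_solomon := qclass os_rel.

End OrlikSolomon.

Definition is_basis (R : pzRingType) (V : lmodType R) (J : finType)
    (b : J -> V) : Prop :=
  (forall c : J -> R, \sum_j c j *: b j = 0 -> forall j, c j = 0) /\
  (forall v : V, exists c : J -> R, v = \sum_j c j *: b j).

(* Main.v *)
Require Import Defs.
From HB Require Import structures.
From mathcomp Require Import all_boot all_order all_algebra.
From mathcomp Require Import fingroup perm ring zify.
From mathcomp.multinomials Require Import monalg.

(** Write at(x) for the atoms below x. Since every P_{<= x} is a geometric
    lattice, the elements of S below a given height x are the sets T of atoms
    below x, each carried by the join [ljoin x T] taken inside P_{<= x}, and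
    I is the family of independent sets of the matroid on at(x).

    Spanning ([spanned_all]). The meet and join relations rewrite a product of
    generators as a combination of single e_gamma with gamma in I. If alpha in
    I contains a broken circuit zeta \ a, then a lies below alpha.1, and adding
    it gives an element omega with flat alpha.1 in which zeta is the only circuit
    ([adjoin_unicircular]); the circuit relation of omega then rewrites e_alpha
    by the elements obtained by trading some b > a of alpha for a. The sum of the
    positions of the atoms drops, so this terminates on nbc elements.

    Independence ([nbc_independent]). For beta in nbc with flat x, let
    x_b be the join of b and the atoms of beta that come after b. These flats form a
    flag ending in x, and [label beta a] is the largest b in beta with
    a <= x_b, that is, the step of the flag at which the atom a appears. Define
    the linear form F_beta ([flag_form]) on words alpha_1 ... alpha_n as 0
    unless every alpha_i.1 is below x, and otherwise as the sign of the sequence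
    of labels of all atoms listed in the word (0 if a label repeats). Two
    facts drive the proof:
    - a set of atoms with pairwise distinct labels is independent
      ([transversal_independent]), because each new step of the flag raises the
      rank;
    - label beta a never comes after a in the order on atoms ([label_le]), because
      an atom a below x_b that came before b would close a circuit whose broken
      circuit lies in beta.

    By the first fact F_beta, extended linearly to the free algebra, vanishes on
    the two-sided ideal generated by all the relations. A repeated atom repeats
    a label, which gives the meet relations. The signs of the concatenated lists
    give graded commutativity and the join relations: at most one element of the
    join set lies below x, and if it is not in I then its labels cannot be
    distinct. For a circuit relation, zeta is dependent, so two of its atoms a, b share a label; the terms
    omega \ a and omega \ b cancel and all others contain both a and b
    ([flag_form_circuit]).

    By the second fact the matrix F_beta (e_gamma) over nbc is triangular with
    diagonal 1, for the weight that sums over the atoms of gamma a positive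
    number decreasing along the order ([flag_form_triangular]): passing to
    labels can only raise the weight, and it ends in a subset of beta. *)

Set Implicit Arguments.
Unset Strict Implicit.
Unset Printing Implicit Defensive.

Import Order.TTheory GRing.Theory Num.Theory.
Import Order.DefaultProdOrder Order.DefaultSetSubsetOrder.

Local Open Scope ring_scope.

(** * Signs of sorting permutations *)

Lemma uniq_map_inj (T U : eqType) (f : T -> U) s :
  uniq (map f s) -> {in s &, injective f}.
Proof.
elim: s => //= a s IHs /andP[fa us] x y.
rewrite !inE => /predU1P[->|xs] /predU1P[->|ys] // fxy; last exact: IHs.
  by rewrite fxy map_f in fa.
by rewrite -fxy map_f in fa.
Qed.

Section PairProducts.
Variable X : eqType.
Implicit Types (q : X -> X -> rat) (s t u v : seq X) (k l : X -> nat).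

Fixpoint pairprod q s : rat :=
  if s is a :: s' then (\prod_(b <- s') q a b) * pairprod q s' else 1.

(** The sign (-1)^(number of inversions) of the word of keys, with value 0 as soon as a
    key repeats: a repeated key is exactly what must annihilate a product below. *)
Definition isgn k : seq X -> rat :=
  pairprod (fun a b => Num.sg ((k b)%:R - (k a)%:R)).

Definition crossprod q s t : rat := \prod_(a <- s) \prod_(b <- t) q a b.

Lemma crossprod_catr q s t u :
  crossprod q s (t ++ u) = crossprod q s t * crossprod q s u.
Proof. by rewrite -big_split; apply: eq_bigr => a _; rewrite big_cat. Qed.

Lemma perm_crossprodl q s t u : perm_eq s t -> crossprod q s u = crossprod q t u.
Proof. exact: perm_big. Qed.

Lemma perm_crossprodr q s t u : perm_eq s t -> crossprod q u s = crossprod q u t.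
Proof. by move=> st; apply: eq_bigr => a _; apply: perm_big. Qed.

(** With c = -1 this is the Koszul sign for exchanging two blocks. *)
Lemma crossprod_flip q c s t : (forall a b, q a b = c * q b a) ->
  crossprod q s t = c ^+ (size s * size t) * crossprod q t s.
Proof.
move=> qc; rewrite /crossprod [in RHS]exchange_big /= mulnC exprM.
elim: s => [|a s IHs]; first by rewrite !big_nil mulr1.
rewrite !big_cons IHs exprS mulrACA; congr (_ * _).
elim: t {IHs} => [|b t IHt]; first by rewrite !big_nil mulr1.
by rewrite !big_cons IHt qc exprS mulrACA.
Qed.

Lemma pairprod_cat q s t :
  pairprod q (s ++ t) = pairprod q s * pairprod q t * crossprod q s t.
Proof.
elim: s => [|a s IHs] /=; first by rewrite /crossprod big_nil; ring.
by rewrite IHs /crossprod big_cat big_cons /=; ring.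
Qed.

Lemma pairprodM q q' s :
  pairprod (fun a b => q a b * q' a b) s = pairprod q s * pairprod q' s.
Proof. by elim: s => [|a s /= ->]; rewrite ?mulr1 // big_split mulrACA. Qed.

(** A symmetric function of the two entries makes the product independent of the
    order, since exchanging adjacent blocks generates all rearrangements. *)
Lemma perm_pairprod q s t :
  (forall a b, q a b = q b a) -> perm_eq s t -> pairprod q s = pairprod q t.
Proof.
move=> q_sym; apply: catCA_perm_subst => s1 s2 s3.
have q1 a b : q a b = 1 * q b a by rewrite mul1r.
rewrite !pairprod_cat !crossprod_catr (crossprod_flip s1 s2 q1) expr1n.
by ring.
Qed.

Lemma isgn_neq0 k s : (isgn k s != 0) = uniq (map k s).
Proof.
elim: s => //= a s IHs; rewrite mulf_eq0 negb_or IHs; congr (_ && _).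
rewrite prodf_seq_neq0 -has_pred1 has_map -all_predC; apply: eq_all => b /=.
by rewrite sgr_eq0 subr_eq0 eqr_nat.
Qed.

Lemma isgn_sq k s : uniq (map k s) -> isgn k s * isgn k s = 1.
Proof.
elim: s => [|a s IHs] /=; first by rewrite mulr1.
case/andP=> kas /IHs ks; rewrite /isgn /= mulrACA -/(isgn k s) ks mulr1.
rewrite -big_split big_seq big1 // => b bs /=.
rewrite -expr2 sqr_sg subr_eq0 eqr_nat.
by case: eqP kas => // <-; rewrite map_f.
Qed.

Lemma isgn_increasing k s : pairwise (fun a b => (k a < k b)%N) s -> isgn k s = 1.
Proof.
elim: s => //= a s IHs /andP[/allP lt_as /IHs ks].
rewrite /isgn /= -/(isgn k s) ks mulr1 big_seq big1 // => b /lt_as kab.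
by rewrite gtr0_sg // subr_gt0 ltr_nat.
Qed.

(** The product of the signs for two keys k and l is a product of a symmetric function
    over pairs, so rearranging a block t changes the l-sign by the same factor as the
    k-sign. *)
Lemma isgn_reorder k l u t t' v : uniq (map k t) -> perm_eq t t' ->
  isgn l (u ++ t ++ v) = isgn k t * isgn k t' * isgn l (u ++ t' ++ v).
Proof.
move=> kt tt'; have kt' : uniq (map k t').
  by rewrite -(perm_uniq (perm_map k tt')).
have lk : isgn l t * isgn k t = isgn l t' * isgn k t'.
  rewrite /isgn -!pairprodM; apply: perm_pairprod => // a b.
  by rewrite -!sgrM; congr (Num.sg _); ring.
have lt : isgn l t = isgn k t * isgn k t' * isgn l t'.
  by rewrite -mulrA [isgn k t' * _]mulrC -lk mulrC -mulrA isgn_sq ?mulr1.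
rewrite /isgn !pairprod_cat -!/(isgn _ _) lt !crossprod_catr.
by rewrite (perm_crossprodl _ _ tt') (perm_crossprodr _ _ tt'); ring.
Qed.

Lemma isgn_swap l u s t v :
  isgn l (u ++ s ++ t ++ v) =
  (-1) ^+ (size s * size t) * isgn l (u ++ t ++ s ++ v).
Proof.
set q := fun a b : X => Num.sg ((l b)%:R - (l a)%:R) : rat.
have qN a b : q a b = -1 * q b a by rewrite mulN1r -sgrN opprB.
rewrite /isgn !pairprod_cat !crossprod_catr -/q (crossprod_flip s t qN).
by ring.
Qed.

Lemma isgn_map k l s t : map k s = map l t -> isgn k s = isgn l t.
Proof.
elim: s t => [|a s IHs] [|b t] //= [kab kst]; rewrite /isgn /= -!/(isgn _ _) (IHs t) //.
congr (_ * _).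
rewrite kab -(big_map k xpredT (fun c => Num.sg (c%:R - (l b)%:R : rat))).
by rewrite kst big_map.
Qed.

End PairProducts.

(** The product of all differences of keys is a Vandermonde determinant; this is what
    connects [isgn] with the sign of a permutation. *)
Lemma isgn_enum (X : eqType) (k : X -> nat) n (f : 'I_n -> X) :
  isgn k [seq f i | i <- enum 'I_n] =
  Num.sg (\det (Vandermonde n (\row_i (k (f i))%:R))).
Proof.
rewrite det_Vandermonde; elim: n f => [|n IHn] f.
  by rewrite enum_ord0 big_ord0 sgr1.
rewrite enum_ordSl /= -map_comp /isgn /= -/(isgn _ _) IHn big_ord_recl sgrM.
congr (_ * _).
  rewrite big_map big_enum (big_morph _ (@sgrM _) (@sgr1 _)) [RHS]big_mkcond.
  rewrite big_ord_recl /= mul1r.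
  by apply: eq_bigr => i _; rewrite !mxE.
congr (Num.sg _); apply: eq_bigr => i _; rewrite [RHS]big_mkcond big_ord_recl /= mul1r.
by rewrite -big_mkcond; apply: eq_bigr => j _; rewrite !mxE.
Qed.

(** A permutation acts on the columns of the Vandermonde matrix. *)
Lemma isgn_perm (X : eqType) (k : X -> nat) (s : seq X) (p : 'S_(size s)) :
  isgn k [tuple tnth (in_tuple s) (p i) | i < size s] = (-1) ^+ p * isgn k s.
Proof.
have -> : isgn k s = isgn k [seq tnth (in_tuple s) i | i <- enum 'I_(size s)].
  by rewrite map_tnth_enum.
rewrite /= !isgn_enum.
have -> : Vandermonde (size s) (\row_i (k (tnth (in_tuple s) (p i)))%:R) =
    col_perm p (Vandermonde (size s) (\row_i (k (tnth (in_tuple s) i))%:R : 'rV[rat]__)).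
  by apply/matrixP => i j; rewrite !mxE.
rewrite col_permE det_mulmx det_perm odd_permV mulrC sgrM.
by rewrite sgrX sgrN1.
Qed.

Lemma sgnE (X : finType) (r : rel X) (k : X -> nat) (A B : {set X}) :
  let s := sort r (enum A) ++ sort r (enum B) in
  isgn k (sort r s) = 1 -> sgn r A B = isgn k s.
Proof.
move=> s sort1; rewrite /sgn -/s /sort_perm.
case: pickP => [p /eqP ps | no_p] /=.
  move: sort1; rewrite -ps isgn_perm => /(congr1 (fun c => (-1) ^+ p * c)).
  by rewrite mulrA -expr2 sqrr_sign mul1r mulr1.
have /tuple_permP[p sp] : perm_eq (sort r s) (in_tuple s) by rewrite perm_sort.
by have := no_p p; rewrite sp eqxx.
Qed.

(** * Linear forms vanishing on a presented graded-commutative algebra *)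

Section Annihilator.
Variables (R : comPzRingType) (A : algType R) (X : Type) (word : seq X -> A).
Hypothesis word_cat : {morph word : s t / s ++ t >-> s * t}.
Hypothesis word_span : forall Q : A -> Prop, Q 0 ->
  (forall y z, Q y -> Q z -> Q (y + z)) -> (forall c y, Q y -> Q (c *: y)) ->
  (forall s, Q (word s)) -> forall y, Q y.
Variable phi : {linear A -> R | *%R}.

(** Testing phi between arbitrary words turns its kernel into a two-sided ideal. *)
Definition kills y : Prop := forall s t, phi (word s * y * word t) = 0.

Lemma kills0 : kills 0.
Proof. by move=> s t; rewrite mulr0 mul0r linear0. Qed.

Lemma killsD y z : kills y -> kills z -> kills (y + z).
Proof. by move=> hy hz s t; rewrite mulrDr mulrDl linearD /= hy hz addr0. Qed.

Lemma killsZ c y : kills y -> kills (c *: y).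
Proof. by move=> hy s t; rewrite -scalerAr -scalerAl linearZ /= hy mulr0. Qed.

(** As words span A, both outer factors may be taken to be words, and these are
    absorbed by the words already surrounding y. *)
Lemma kills_ideal : two_sided_ideal kills.
Proof.
split; [exact: kills0 | exact: killsD |].
move=> a y b hy; elim/word_span: a => [|a a' ha ha'|c a ha|u].
- by rewrite !mul0r; apply: kills0.
- by rewrite !mulrDl; apply: killsD.
- by rewrite -!scalerAl; apply: killsZ.
elim/word_span: b => [|b b' hb hb'|c b hb|v].
- by rewrite mulr0; apply: kills0.
- by rewrite mulrDr; apply: killsD.
- by rewrite -scalerAr; apply: killsZ.
move=> s t; rewrite -[RHS](hy (s ++ u) (v ++ t)) !word_cat.
by rewrite !mulrA.
Qed.

Lemma kills_sum (J : finType) (p : pred J) (c : J -> R) (w : J -> seq X) s t :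
  phi (word s * (\sum_(j | p j) c j *: word (w j)) * word t) =
  \sum_(j | p j) c j * phi (word (s ++ w j ++ t)).
Proof.
rewrite mulr_sumr mulr_suml linear_sum; apply: eq_bigr => j _ /=.
by rewrite -scalerAr -scalerAl linearZ /= !word_cat mulrA.
Qed.

End Annihilator.

(** A two-sided ideal K of A that contains the kernel of pi and representatives of the
    generators of an ideal of B contains the whole preimage of that ideal. This lets the
    quotients by graded commutativity and by the Orlik-Solomon relations be treated by
    a single linear form on the free algebra. *)
Lemma ideal_gen_lift (R : comPzRingType) (A B : algType R) (pi : A -> B)
    (K : A -> Prop) (G : B -> Prop) :
  (forall b, exists a, pi a = b) ->
  {morph pi : y z / y + z} -> {morph pi : y z / y * z} ->
  two_sided_ideal K -> (forall y z, pi y = pi z -> K (z - y)) ->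
  (forall g, G g -> exists2 y, pi y = g & K y) ->
  forall y, pi y \in ideal_gen G -> K y.
Proof.
move=> pi_surj piD piM [K0 KD KM] piK KG.
have lift y z : pi y = pi z -> K y -> K z.
  by move=> /piK Kzy Ky; rewrite -(subrK y z); apply: KD.
move=> y /in_ideal_gen/(_ (fun b => forall z, pi z = b -> K z)) H; apply: H => //.
  split=> [z z0 | b1 b2 h1 h2 z | a x b hx z].
  (* z0 : pi z = 0, so z + z and z have the same image and K contains z - (z + z). *)
  - have /piK : pi (z + z) = pi z by rewrite piD z0 addr0.
    rewrite opprD addrA subrr sub0r => /(KM (-1) _ 1).
    by rewrite mulN1r mulr1 opprK.
  - have [[y1 e1] [y2 e2]] := (pi_surj b1, pi_surj b2).
    by rewrite -e1 -e2 -piD => /esym/lift; apply; apply: KD; [apply: h1 | apply: h2].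
  have [[a' <-] [b' <-] [x' ex]] := And3 (pi_surj a) (pi_surj b) (pi_surj x).
  by rewrite -ex -!piM => /esym/lift; apply; apply: KM; apply: hx.
by move=> g /KG[z <- Kz] z' /esym/lift; apply.
Qed.

Section Words.
Variable X : choiceType.
Implicit Types (s t : seq X) (y : free_alg X) (h : seq X -> rat).

Definition word s : free_alg X := \prod_(i <- s) free_gen i.

Lemma word_cat s t : word (s ++ t) = word s * word t.
Proof. exact: big_cat. Qed.

Lemma word1 i : word [:: i] = free_gen i.
Proof. exact: big_seq1. Qed.

(** Words are the monomials, hence a basis of the free algebra. *)
Lemma wordE s : word s = << FMonom s >>.
Proof.
elim: s => [|i s IHs]; first by rewrite /word big_nil -fmoneE.
rewrite /word big_cons -/(word s) IHs [LHS]malgM_def fgmulUU mulr1.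
by congr (<< _ >>); apply: val_inj; rewrite /= fmM fmU.
Qed.

Lemma free_alg_ind (Q : free_alg X -> Prop) :
  Q 0 -> (forall y z, Q y -> Q z -> Q (y + z)) -> (forall c y, Q y -> Q (c *: y)) ->
  (forall s, Q (word s)) -> forall y, Q y.
Proof.
move=> Q0 QD QZ Qw y; rewrite [y]monalgE; apply: big_ind => // k _.
have -> : << y@_k *g k >> = y@_k *: word k.
  apply/malgP => k'; rewrite mcoeffZ wordE !mcoeffU mulr_natr.
  by case: k => k.
exact/QZ/Qw.
Qed.

Definition extend h y : rat := mmap idfun (h \o @fmonom_val X) y.

Lemma extend_linear h : linear_for *%R (extend h).
Proof.
move=> c y z; rewrite /extend mmapD; congr (_ + _).
rewrite (mmapEw (msuppZ_le c y)) mmapE mulr_sumr; apply: eq_bigr => k _.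
by rewrite /= mcoeffZ mulrA.
Qed.

HB.instance Definition _ h :=
  GRing.isLinear.Build rat (free_alg X) rat *%R (extend h) (extend_linear h).

Lemma extend_word h s : extend h (word s) = h s.
Proof. by rewrite wordE /extend mmapU /= mul1r. Qed.


Lemma gc_rel_kills (deg : X -> nat) h :
  (forall s t i j, h (s ++ i :: j :: t) = (-1) ^+ (deg i * deg j) * h (s ++ j :: i :: t)) ->
  forall g, gc_rel deg g -> kills word (extend h) g.
Proof.
move=> hsym _ [i j] s t; rewrite -!word1 -!word_cat mulrBr mulrBl linearB /=.
rewrite -scalerAr -scalerAl linearZ /= -!word_cat !extend_word -!catA /= hsym.
by rewrite subrr.
Qed.

Lemma extend_ideal0 (deg : X -> nat) h (G : free_gc_alg deg -> Prop) :
  (forall s t i j, h (s ++ i :: j :: t) = (-1) ^+ (deg i * deg j) * h (s ++ j :: i :: t)) ->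
  (forall g, G g -> exists2 y, qclass (gc_rel deg) y = g & kills word (extend h) y) ->
  forall y, qclass (gc_rel deg) y \in ideal_gen G -> extend h y = 0.
Proof.
move=> hsym hG y yG.
have kI : two_sided_ideal (kills word (extend h)).
  by apply: kills_ideal; [exact: word_cat | exact: free_alg_ind].
have kgc g : g \in ideal_gen (gc_rel deg) -> kills word (extend h) g.
  by move/in_ideal_gen/(_ _ kI); apply; apply: gc_rel_kills.
have : kills word (extend h) y.
  apply: (@ideal_gen_lift rat (free_alg X) (free_gc_alg deg) (qclass (gc_rel deg))
    _ G _ _ _ kI _ hG y yG).
  - by move=> b; elim/(@qclass_ind _ _ (gc_rel deg)): b => z; exists z.
  - exact: qclassD.
  - exact: qclassM.
  - by move=> u v /esym/eqP; rewrite qclass_eq => /kgc.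
by move=> /(_ [::] [::]); rewrite /word !big_nil mul1r mulr1.
Qed.

End Words.
Arguments word {X}.
Arguments word_cat {X}.

(** * Ranks and local joins *)

Lemma minimals_below d (X : finPOrderType d) (A : {set X}) y : y \in A ->
  exists2 m, m \in minimals A & (m <= y)%O.
Proof.
move=> yA; have yP : (y \in A) && (y <= y)%O by rewrite yA lexx.
case: (@arg_minnP _ y (fun m => (m \in A) && (m <= y)%O)
  (fun m => #|[set z in A | (z <= m)%O]|) yP) => m /andP[mA my] m_min.
exists m => //; rewrite inE mA /=; apply/forall_inP => z zA; apply/implyP => zm.
have := m_min z; rewrite zA (le_trans zm my) => /(_ isT) card_le.
have sub : [set w in A | (w <= z)%O] \subset [set w in A | (w <= m)%O].
  by apply/subsetP => w; rewrite !inE => /andP[-> /le_trans->].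
have /setP/(_ m) : [set w in A | (w <= z)%O] = [set w in A | (w <= m)%O].
  by apply/eqP; rewrite eqEcard sub card_le.
by rewrite !inE mA lexx eq_le zm => /= ->.
Qed.

Lemma maximals_above d (X : finPOrderType d) (A : {set X}) y : y \in A ->
  exists2 m, m \in maximals A & (y <= m)%O.
Proof.
move=> yA; have yP : (y \in A) && (y <= y)%O by rewrite yA lexx.
case: (@arg_minnP _ y (fun m => (m \in A) && (y <= m)%O)
  (fun m => #|[set z in A | (m <= z)%O]|) yP) => m /andP[mA my] m_min.
exists m => //; rewrite inE mA /=; apply/forall_inP => z zA; apply/implyP => mz.
have := m_min z; rewrite zA (le_trans my mz) => /(_ isT) card_le.
have sub : [set w in A | (z <= w)%O] \subset [set w in A | (m <= w)%O].
  by apply/subsetP => w; rewrite !inE => /andP[-> /(le_trans mz)->].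
have /setP/(_ m) : [set w in A | (z <= w)%O] = [set w in A | (m <= w)%O].
  by apply/eqP; rewrite eqEcard sub card_le.
by rewrite !inE mA lexx eq_le mz andbT => /= ->.
Qed.

Lemma unique_join d (X : finPOrderType d) (D T : {set X}) :
  #|joins D T| = 1%N -> exists j,
  [/\ joins D T = [set j], j \in D, {in T, forall t, (t <= j)%O}
    & {in D, forall w, {in T, forall t, (t <= w)%O} -> (j <= w)%O}].
Proof.
move=> /eqP/cards1P[j jE]; exists j.
have: j \in joins D T by rewrite jE inE.
rewrite inE => /andP[+ _]; rewrite inE => /andP[jD /forall_inP Tj].
split=> // w wD Tw.
have /minimals_below[m + mw] : w \in [set y in D | [forall x in T, (x <= y)%O]].
  by rewrite inE wD; apply/forall_inP.
by rewrite -[minimals _]/(joins D T) jE inE => /eqP <-.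
Qed.

Lemma unique_meet d (X : finPOrderType d) (D T : {set X}) :
  #|meets D T| = 1%N -> exists j,
  [/\ meets D T = [set j], j \in D, {in T, forall t, (j <= t)%O}
    & {in D, forall w, {in T, forall t, (w <= t)%O} -> (w <= j)%O}].
Proof.
move=> /eqP/cards1P[j jE]; exists j.
have: j \in meets D T by rewrite jE inE.
rewrite inE => /andP[+ _]; rewrite inE => /andP[jD /forall_inP Tj].
split=> // w wD Tw.
have /maximals_above[m + mw] : w \in [set y in D | [forall x in T, (y <= x)%O]].
  by rewrite inE wD; apply/forall_inP.
by rewrite -[maximals _]/(meets D T) jE inE => /eqP <-.
Qed.

Section Rank.
Context {d : Order.disp_t} {P : finBPOrderType d}.
Variable rho : P -> nat.
Hypothesis hrho : rank_function [set: P] rho.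
Implicit Types x y z : P.

Lemma rank_bot : rho \bot%O = 0%N.
Proof. by case: hrho => _ h _; apply: h; split=> [|y _]; rewrite ?inE ?le0x. Qed.

(** Ranks are only controlled along covers, so a strict inequality has to be refined by
    a cover of the larger element. *)
Lemma lower_cover (D : {set P}) y z : (y < z)%O -> y \in D ->
  exists c, [/\ c \in D, (y <= c)%O, (c < z)%O & covers D c z].
Proof.
move=> yz yD; have yA : y \in [set w in D | (y <= w)%O && (w < z)%O].
  by rewrite !inE yD lexx yz.
have [c + yc] := maximals_above yA; rewrite !inE -andbA.
move=> /and3P[cD /andP[_ cz] /forall_inP cmax].
exists c; split=> //; split=> // -[w wD /andP[cw wz]].
have := cmax w; rewrite inE wD (le_trans yc (ltW cw)) wz (ltW cw) => /(_ isT) /eqP wc.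
by rewrite wc ltxx in cw.
Qed.

Lemma rank_lt y z : (y < z)%O -> (rho y < rho z)%N.
Proof.
case: hrho => mono _ cov yz; have [c [_ yc _ cz]] := lower_cover yz (in_setT y).
by rewrite (cov c z) ?inE // ltnS mono ?inE.
Qed.

Lemma rank_le y z : (y <= z)%O -> (rho y <= rho z)%N.
Proof. by case: hrho => mono _ _; apply: mono; rewrite inE. Qed.

Lemma rank_le_eq y z : (y <= z)%O -> (rho z <= rho y)%N -> y = z.
Proof. by rewrite le_eqVlt => /predU1P[//|/rank_lt]; rewrite ltnNge => /negP. Qed.

(** The rank function supplied with the geometric lattice P_{<= x} need not be rho, but
    covers inside P_{<= x} are covers in P, so both are given by the same induction. *)
Lemma rank_function_unique x rho' :
  rank_function [set y | (y <= x)%O] rho' ->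
  forall y, (y <= x)%O -> rho' y = rho y.
Proof.
case: hrho => mono bot0 cov [mono' bot0' cov'] y.
have [n] := ubnP (rho y); elim: n y => // n IHn y le_n yx.
have [->|ny0] := eqVneq y \bot%O.
  rewrite rank_bot bot0' //; split; first by rewrite inE le0x.
  by move=> z _; apply: le0x.
have y0 : (\bot < y)%O by rewrite lt0x.
have [|c [cx _ cy [_ ccov]]] := @lower_cover [set y | (y <= x)%O] _ _ y0.
  by rewrite inE le0x.
rewrite inE in cx; have covT : covers [set: P] c y.
  split=> // -[w _ /andP[cw wy]]; apply: ccov; exists w; last by rewrite cw.
  by rewrite inE (le_trans (ltW wy)).
have e := cov c y (in_setT _) (in_setT _) covT.
by rewrite e (cov' c y) ?inE // IHn //; rewrite e ltnS in le_n.
Qed.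

End Rank.

Lemma nat_modular (u i a b j m : nat) :
  (u <= j -> j + m <= a + b -> u + i = a + b -> m <= i)%N.
Proof. lia. Qed.

Section Independence.
Context {d : Order.disp_t} {P : finBPOrderType d}.
Variables (rho : P -> nat) (r : rel P).
Hypotheses (hP : locally_geometric P) (hrho : rank_function [set: P] rho).
Local Notation at_ := (atoms [set: P] rho).
Hypothesis hr : linear_order_on at_ r.
Local Notation pairs := (P * {set P})%type.
Local Notation S_ := (S_ rho).
Local Notation I_ := (I_ rho).
Local Notation del := (del rho).
Local Notation circuits := (circuits rho).
Local Notation nbc := (nbc rho r).
Implicit Types (x y z : P) (T : {set P}) (alpha beta gamma zeta omega : pairs).

(** The order-theoretic and numerical content of P_{<= x} being a geometric lattice, in
    terms of the global rank. *)
Lemma local_join x y z : (y <= x)%O -> (z <= x)%O -> exists j m,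
  [/\ [/\ (j <= x)%O, (y <= j)%O & (z <= j)%O],
      (forall w, (w <= x)%O -> (y <= w)%O -> (z <= w)%O -> (j <= w)%O),
      (forall w, (w <= y)%O -> (w <= z)%O -> (w <= m)%O)
    & (rho j + rho m <= rho y + rho z)%N].
Proof.
case: hP => _ /(_ x) [lat _ [rho' [rho'P _ semi]]] yx zx.
have rhoE := rank_function_unique hrho rho'P.
have yD : y \in [set y | (y <= x)%O] by rewrite inE.
have zD : z \in [set y | (y <= x)%O] by rewrite inE.
have [/unique_join[j [jE jD jub jle]] /unique_meet[m [mE mD mlb mge]]] := lat y z yD zD.
have := semi y z yD zD j m jE mE; rewrite inE in jD; rewrite inE in mD.
rewrite !rhoE // => semi_yz.
have yj : (y <= j)%O by apply: jub; rewrite !inE eqxx.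
have zj : (z <= j)%O by apply: jub; rewrite !inE eqxx orbT.
exists j, m; split=> // [w wx yw zw | w wy wz].
  by apply: jle; rewrite ?inE // => t; rewrite !inE => /orP[]/eqP->.
apply: mge; first by rewrite inE (le_trans wy yx).
by move=> t; rewrite !inE => /orP[]/eqP->.
Qed.

(** The join of T in the lattice P_{<= x}. In P itself T may have several minimal upper
    bounds, which is why the height x is a parameter; the default x is not reached when
    x bounds T. *)
Definition ljoin x T : P := odflt x [pick j | [&& (j <= x)%O,
  [forall t in T, (t <= j)%O] &
  [forall w, (w <= x)%O ==> [forall t in T, (t <= w)%O] ==> (j <= w)%O]]].

Definition bounds x T := {in T, forall t, (t <= x)%O}.

Lemma bounds_sub x T T' : T' \subset T -> bounds x T -> bounds x T'.
Proof. by move=> /subsetP sub xT t /sub; apply: xT. Qed.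

Lemma bounds_le x y T : (x <= y)%O -> bounds x T -> bounds y T.
Proof. by move=> xy xT t /xT tx; apply: le_trans xy. Qed.

Lemma ljoin_spec x T : bounds x T ->
  [/\ (ljoin x T <= x)%O, bounds (ljoin x T) T
    & forall w, (w <= x)%O -> bounds w T -> (ljoin x T <= w)%O].
Proof.
move=> xT; rewrite /ljoin; case: pickP => [j /and3P[jx /forall_inP Tj /forall_inP jle] /=|].
  split=> // w wx wT; have /implyP := jle w wx; apply; exact/forall_inP.
have [j [jx jub jle]] : exists j, [/\ (j <= x)%O, {in enum T, forall t, (t <= j)%O} &
    forall w, (w <= x)%O -> {in enum T, forall t, (t <= w)%O} -> (j <= w)%O].
  have: {in enum T, forall t, (t <= x)%O} by move=> t; rewrite mem_enum; apply: xT.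
  elim: (enum T) => [|a s IHs] sx.
    by exists \bot%O; split=> [|//|w _ _]; rewrite le0x.
  have [t ts|j [jx jub jle]] := IHs; first by apply: sx; rewrite inE ts orbT.
  have ax : (a <= x)%O by apply: sx; rewrite inE eqxx.
  have [k [m [[kx ak jk] kle _ _]]] := local_join ax jx.
  exists k; split=> // [t | w wx sw].
    by rewrite inE => /predU1P[->//|/jub /le_trans->].
  apply: kle => //; first by apply: sw; rewrite inE eqxx.
  by apply: jle => // t ts; apply: sw; rewrite inE ts orbT.
move=> /(_ j) /negP[]; rewrite jx /=; apply/andP; split.
  by apply/forall_inP => t tT; apply: jub; rewrite mem_enum.
apply/forall_inP => w wx; apply/implyP => /forall_inP wT.
by apply: jle => // t; rewrite mem_enum; apply: wT.
Qed.

Lemma ljoin_le x T : bounds x T -> (ljoin x T <= x)%O. Proof. by case/ljoin_spec. Qed.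
Lemma ljoin_bounds x T : bounds x T -> bounds (ljoin x T) T. Proof. by case/ljoin_spec. Qed.
Lemma ljoin_least x T w : bounds x T -> (w <= x)%O -> bounds w T -> (ljoin x T <= w)%O.
Proof. by case/ljoin_spec => _ _; apply. Qed.

Lemma ljoin_sub x T T' : bounds x T -> T' \subset T -> (ljoin x T' <= ljoin x T)%O.
Proof.
move=> xT sub; have xT' := bounds_sub sub xT.
by apply: ljoin_least => //; [exact: ljoin_le | exact/(bounds_sub sub)/ljoin_bounds].
Qed.

Lemma ljoin0 x : ljoin x set0 = \bot%O.
Proof. by apply: le_anti; rewrite le0x andbT ljoin_least ?le0x // => t; rewrite inE. Qed.

(** Upper bounds of T below y are among those below x, and the join below x is itself
    below y. *)
Lemma ljoin_local x y T : (y <= x)%O -> bounds y T -> ljoin y T = ljoin x T.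
Proof.
move=> yx yT; have xT := bounds_le yx yT.
have jy : (ljoin x T <= y)%O by apply: ljoin_least.
apply: le_anti; apply/andP; split; apply: ljoin_least => //; try exact: ljoin_bounds.
exact: le_trans (ljoin_le yT) yx.
Qed.

(** Semimodularity for a and the join of T: an atom has rank one. *)
Lemma rank_ljoinU1 x T a : bounds x T -> (a <= x)%O -> a \in at_ ->
  (rho (ljoin x (a |: T)) <= (rho (ljoin x T)).+1)%N.
Proof.
move=> xT ax; rewrite !inE /= => /eqP a1.
have xaT : bounds x (a |: T) by move=> t /setU1P[->//|]; apply: xT.
have [j [m [[jx aj Tj] jle _]]] := local_join ax (ljoin_le xT).
rewrite a1 add1n => semi; apply: leq_trans (leq_trans _ semi); last exact: leqnn.
apply: leq_trans (leq_addr _ _); apply: (rank_le hrho); apply: ljoin_least => // t.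
by case/setU1P => [->//|/(ljoin_bounds xT)/le_trans->].
Qed.

Lemma rank_ljoinU1_eq x T a : bounds x T -> (a <= x)%O -> a \in at_ ->
  ~~ (a <= ljoin x T)%O -> rho (ljoin x (a |: T)) = (rho (ljoin x T)).+1.
Proof.
move=> xT ax a1 aT; apply/eqP; rewrite eqn_leq rank_ljoinU1 //=.
have xaT : bounds x (a |: T) by move=> t /setU1P[->//|]; apply: xT.
apply: (rank_lt hrho); rewrite lt_def ljoin_sub ?subsetUr // andbT.
by apply: contraNneq aT => <-; apply: ljoin_bounds; rewrite ?inE ?eqxx.
Qed.

Lemma rank_ljoin_sub x T T' : bounds x T -> T \subset at_ -> T' \subset T ->
  (rho (ljoin x T) <= rho (ljoin x T') + #|T :\: T'|)%N.
Proof.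
move=> xT Tat sub; have [n] := ubnP #|T :\: T'|; elim: n T xT Tat sub => // n IHn T xT Tat sub.
have [|[a aT]] := set_0Vmem (T :\: T').
  move=> /eqP; rewrite setD_eq0 => sub' _.
  have -> : T = T' by apply/eqP; rewrite eqEsubset sub'.
  exact: leq_addr.
rewrite (cardsD1 a) aT add1n ltnS => lt_n.
have /andP[aT' aT1] : (a \notin T') && (a \in T) by rewrite -in_setD.
have subD : T :\ a \subset T by apply: subsetDl.
have eD : (T :\ a) :\: T' = (T :\: T') :\ a by apply/setP => t; rewrite !inE andbCA.
have sub' : T' \subset T :\ a by rewrite subsetD1 sub.
have := IHn _ (bounds_sub subD xT) (subset_trans subD Tat) sub'.
rewrite eD => /(_ lt_n) le1; rewrite addnS.
have := @rank_ljoinU1 x (T :\ a) a (bounds_sub subD xT) (xT _ aT1) (subsetP Tat _ aT1).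
by rewrite setD1K // => /leq_trans; apply; rewrite ltnS.
Qed.

Lemma rank_ljoin_card x T : bounds x T -> T \subset at_ -> (rho (ljoin x T) <= #|T|)%N.
Proof.
move=> xT Tat; have := rank_ljoin_sub xT Tat (sub0set T).
by rewrite ljoin0 (rank_bot hrho) setD0.
Qed.

(** Each atom raises the rank by at most one, so removing atoms from a set of full rank
    cannot lose more rank than elements. *)
Lemma independent_sub x T T' : bounds x T -> T \subset at_ -> T' \subset T ->
  rho (ljoin x T) = #|T| -> rho (ljoin x T') = #|T'|.
Proof.
move=> xT Tat sub eT; apply/eqP; rewrite eqn_leq.
rewrite (rank_ljoin_card (bounds_sub sub xT) (subset_trans sub Tat)) /=.
have := rank_ljoin_sub xT Tat sub; rewrite eT cardsD (setIidPr sub).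
by rewrite addnC -leq_subLR subKn ?subset_leq_card.
Qed.

Lemma independent_notin x T a : bounds x T -> T \subset at_ -> a \in T ->
  rho (ljoin x T) = #|T| -> ~~ (a <= ljoin x (T :\ a))%O.
Proof.
move=> xT Tat aT eT; apply/negP => aD.
have sub : T :\ a \subset T by apply: subsetDl.
have xD := bounds_sub sub xT; have := rank_ljoin_card xD (subset_trans sub Tat).
have -> : ljoin x (T :\ a) = ljoin x T.
  apply: le_anti; rewrite ljoin_sub // ljoin_least ?ljoin_le // => t tT.
  by have [->//|ta] := eqVneq t a; apply: ljoin_bounds; rewrite // !inE ta.
by rewrite eT (cardsD1 a T) aT add1n ltnn.
Qed.

(** Joins of subsets of an independent set are modular: semimodularity bounds the rank
    of the meet by |A| + |B| - |A u B|, which the join of the intersection already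
    attains. This is the form of circuit elimination used for uniqueness of circuits. *)
Lemma independent_meet x T (A B : {set P}) a : bounds x T -> T \subset at_ ->
  rho (ljoin x T) = #|T| -> A \subset T -> B \subset T ->
  (a <= ljoin x A)%O -> (a <= ljoin x B)%O -> (a <= ljoin x (A :&: B))%O.
Proof.
move=> xT Tat eT AT BT aA aB.
have [xA xB] := (bounds_sub AT xT, bounds_sub BT xT).
have UT : A :|: B \subset T by rewrite subUset AT.
have IT : A :&: B \subset T by rewrite (subset_trans _ AT) ?subsetIl.
have [j [m [[jx Aj Bj] _ mge semi]]] := local_join (ljoin_le xA) (ljoin_le xB).
rewrite (independent_sub xT Tat AT eT) (independent_sub xT Tat BT eT) in semi.
have : (rho (ljoin x (A :|: B)) <= rho j)%N.
  apply: (rank_le hrho); apply: ljoin_least => // [|t]; first exact: bounds_sub UT xT.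
  by case/setUP => [/(ljoin_bounds xA)|/(ljoin_bounds xB)] /le_trans->.
rewrite (independent_sub xT Tat UT eT) => Uj.
have Im : (ljoin x (A :&: B) <= m)%O.
  have xI := bounds_sub IT xT.
  by apply: mge; apply: ljoin_sub; rewrite ?subsetIl ?subsetIr.
rewrite (rank_le_eq hrho Im); first exact: mge.
rewrite (independent_sub xT Tat IT eT).
exact: (nat_modular Uj semi (cardsUI A B)).
Qed.

(** * Independent elements and circuits *)

Lemma le_pairE alpha beta :
  (alpha <= beta)%O = (alpha.1 <= beta.1)%O && (alpha.2 \subset beta.2).
Proof. by rewrite leEprod. Qed.

(** Being a minimal upper bound of T only depends on P_{<= x}, where minimal upper bounds
    are joins. *)
Lemma S_P alpha : reflect
  [/\ alpha.2 \subset at_, bounds alpha.1 alpha.2 & alpha.1 = ljoin alpha.1 alpha.2]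
  (alpha \in S_).
Proof.
rewrite inE; apply: (iffP andP) => [[Tat p] | [Tat xT xE]]; split=> //.
- by move: p; rewrite !inE => /andP[/forall_inP].
- have xT : bounds alpha.1 alpha.2.
    by move: p; rewrite !inE => /andP[/forall_inP].
  move: p; rewrite inE => /andP[_ /forall_inP/(_ (ljoin alpha.1 alpha.2))].
  rewrite !inE ljoin_le // => h; apply/esym/eqP; apply: h => /=.
  by apply/forall_inP; apply: ljoin_bounds.
rewrite !inE; apply/andP; split; first exact/forall_inP.
apply/forall_inP => w; rewrite !inE => /forall_inP wT; apply/implyP => wx.
by rewrite eq_le wx [X in (X <= _)%O]xE ljoin_least.
Qed.

Lemma S_local x alpha : alpha \in S_ -> (alpha.1 <= x)%O ->
  bounds x alpha.2 /\ alpha.1 = ljoin x alpha.2.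
Proof.
move=> /S_P[_ aT aE] ax; split; first exact: bounds_le aT.
by rewrite -(ljoin_local ax aT).
Qed.

Lemma S_atoms alpha : alpha \in S_ -> alpha.2 \subset at_.
Proof. by case/S_P. Qed.

Lemma ljoin_S x T : T \subset at_ -> bounds x T -> (ljoin x T, T) \in S_.
Proof.
move=> Tat xT; apply/S_P; split=> //=; first exact: ljoin_bounds.
by rewrite (ljoin_local (ljoin_le xT)) //; apply: ljoin_bounds.
Qed.

Lemma S_le x alpha beta : alpha \in S_ -> beta \in S_ ->
  (alpha.1 <= x)%O -> (beta.1 <= x)%O -> alpha.2 \subset beta.2 -> (alpha <= beta)%O.
Proof.
move=> aS bS ax bx sub; rewrite le_pairE sub andbT.
have [_ ->] := S_local aS ax; have [xb ->] := S_local bS bx.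
exact: ljoin_sub.
Qed.

(** Below a common height an element of S is determined by its atoms; this is what makes
    the lower sets of S Boolean. *)
Lemma S_inj x alpha beta : alpha \in S_ -> beta \in S_ ->
  (alpha.1 <= x)%O -> (beta.1 <= x)%O -> alpha.2 = beta.2 -> alpha = beta.
Proof.
by move=> aS bS ax bx e; apply: le_anti; rewrite !(@S_le x) // e.
Qed.

Lemma I_P alpha : reflect (alpha \in S_ /\ rho alpha.1 = #|alpha.2|) (alpha \in I_).
Proof.
by rewrite [alpha \in I_]in_set; apply: (iffP idP) => [/andP[-> /eqP]|[-> /eqP]].
Qed.

Lemma I_S alpha : alpha \in I_ -> alpha \in S_. Proof. by case/I_P. Qed.

Lemma bot_I : \bot%O \in I_.
Proof.
apply/I_P; rewrite (rank_bot hrho) cards0; split=> //; apply/S_P; split=> /=.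
- by rewrite sub0set.
- by move=> t; rewrite inE.
by rewrite ljoin0.
Qed.

Lemma I_sub alpha beta : alpha \in I_ -> beta \in S_ -> (beta <= alpha)%O ->
  beta \in I_.
Proof.
move=> /I_P[aS aE] bS; rewrite le_pairE => /andP[ba sub]; apply/I_P; split=> //.
have [_ ->] := S_local bS ba; have /S_P[Tat xT jE] := aS.
by apply: independent_sub (sub) _ => //; rewrite -jE.
Qed.

Lemma ljoin_I alpha T : alpha \in I_ -> T \subset alpha.2 -> (ljoin alpha.1 T, T) \in I_.
Proof.
move=> aI sub; have /I_P[/S_P[Tat xT jE] _] := aI; apply: (I_sub aI) => /=.
  by apply: ljoin_S; [exact: subset_trans Tat | exact: bounds_sub xT].
rewrite le_pairE /= sub andbT; exact: ljoin_le (bounds_sub sub xT).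
Qed.

Lemma delE omega a : omega \in S_ ->
  del omega a = (ljoin omega.1 (omega.2 :\ a), omega.2 :\ a).
Proof.
move=> wS; have /S_P[Tat xT jE] := wS.
have sub : omega.2 :\ a \subset omega.2 by apply: subsetDl.
have dS := ljoin_S (subset_trans sub Tat) (bounds_sub sub xT).
have dw : (ljoin omega.1 (omega.2 :\ a) <= omega.1)%O by apply: ljoin_le (bounds_sub sub xT).
rewrite /Defs.del; case: pickP => [beta /and3P[bS bw /eqP b2] | /(_ _ )/=no].
  apply: (S_inj (x := omega.1)) => //; by move: bw; rewrite le_pairE => /andP[].
have := no (ljoin omega.1 (omega.2 :\ a), omega.2 :\ a).
by rewrite dS le_pairE dw sub eqxx.
Qed.

Lemma del_S omega a : omega \in S_ -> del omega a \in S_.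
Proof.
move=> wS; rewrite delE //; have /S_P[Tat xT _] := wS.
apply: ljoin_S; first exact: subset_trans (subsetDl _ _) Tat.
exact: bounds_sub (subsetDl _ _) xT.
Qed.

Lemma del_le omega a : omega \in S_ -> (del omega a <= omega)%O.
Proof.
move=> wS; rewrite delE //; have /S_P[Tat xT _] := wS.
by rewrite le_pairE /= subsetDl andbT; apply: ljoin_le (bounds_sub (subsetDl _ _) xT).
Qed.

Lemma circuitP zeta : reflect
  [/\ zeta \in S_, zeta \notin I_
    & forall beta, beta \in S_ -> (beta <= zeta)%O -> beta != zeta -> beta \in I_]
  (zeta \in circuits).
Proof.
rewrite [zeta \in circuits]in_set; apply: (iffP andP).
  case=> /setDP[zS zI] /forall_inP zmin; split=> // beta bS bz.
  apply: contraNT => bI; have /implyP := zmin beta (introT setDP (conj bS bI)).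
  exact.
case=> zS zI zmin; split; first exact/setDP.
apply/forall_inP => beta /setDP[bS bI]; apply/implyP => bz.
by apply: contraNT bI; apply: zmin.
Qed.

Lemma circuit_S zeta : zeta \in circuits -> zeta \in S_.
Proof. by case/circuitP. Qed.

Lemma circuit_dependent zeta omega : zeta \in circuits -> omega \in I_ ->
  ~~ (zeta <= omega)%O.
Proof.
move=> /circuitP[zS zI _] wI; apply: contra zI; exact: I_sub.
Qed.

Lemma dependent_circuit omega : omega \in S_ -> omega \notin I_ ->
  exists2 zeta, zeta \in circuits & (zeta <= omega)%O.
Proof. by move=> wS wI; apply: minimals_below; apply/setDP. Qed.

Lemma circuit_sub zeta beta : zeta \in circuits -> beta \in S_ ->
  (beta <= zeta)%O -> beta != zeta -> beta \in I_.
Proof. by case/circuitP => _ _; apply. Qed.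

(** A circuit has rank one less than its size, the same as any of its maximal proper
    subsets, so the removed atom stays below their join. *)
Lemma circuit_del zeta a : zeta \in circuits -> a \in zeta.2 ->
  del zeta a \in I_ /\ (del zeta a).1 = zeta.1.
Proof.
move=> zC az; have zS := circuit_S zC.
have dI : del zeta a \in I_.
  apply: (circuit_sub zC); [exact: del_S | exact: del_le |].
  by apply: contraTneq az => <-; rewrite delE //= !inE eqxx.
split=> //; have := del_le a zS; rewrite le_pairE => /andP[dz _].
apply: (rank_le_eq hrho dz); have /I_P[_ ->] := dI; rewrite delE //=.
have /S_P[Tat xT jE] := zS; rewrite -ltnS.
have -> : (#|zeta.2 :\ a|.+1 = #|zeta.2|)%N by rewrite [RHS](cardsD1 a) az.
rewrite ltn_neqAle [in X in _ && X]jE rank_ljoin_card // andbT.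
apply: contraT => /negPn/eqP ez.
have zI : zeta \in I_ by apply/I_P.
by have := circuit_dependent zC zI; rewrite lexx.
Qed.

Lemma circuit_neq0 zeta : zeta \in circuits -> zeta.2 != set0.
Proof.
move=> zC; apply/eqP => z0; have /S_P[_ _ zE] := circuit_S zC.
have zb : zeta = \bot%O by rewrite [zeta]surjective_pairing zE z0 ljoin0.
by have := circuit_dependent zC bot_I; rewrite zb lexx.
Qed.

Lemma unicircularP zeta omega : reflect
  [/\ omega \in S_, zeta \in circuits, (zeta <= omega)%O
    & forall zeta', zeta' \in circuits -> (zeta' <= omega)%O -> zeta' = zeta]
  (unicircular rho zeta omega).
Proof.
apply: (iffP and4P) => -[wS zC zw] h; split=> //.
  by move=> z' z'C z'w; apply/eqP; move/forall_inP/(_ z' z'C)/implyP: h; apply.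
by apply/forall_inP => z' z'C; apply/implyP => z'w; apply/eqP; apply: h.
Qed.

(** Removing an atom of the only circuit destroys it, and by [circuit_del] leaves the top
    unchanged. *)
Lemma unicircular_del zeta omega a : unicircular rho zeta omega -> a \in zeta.2 ->
  del omega a \in I_ /\ del omega a = (omega.1, omega.2 :\ a).
Proof.
move=> /unicircularP[wS zC zw zuniq] az; split.
  apply/negP => /negP /dependent_circuit[|z' z'C z'd]; first exact: del_S.
  have e : z' = zeta by apply: zuniq => //; apply: le_trans z'd (del_le a wS).
  by move: z'd; rewrite e delE // le_pairE => /andP[_ /subsetP/(_ _ az)]; rewrite !inE eqxx.
rewrite delE //; congr pair; have /S_P[Tat xT wE] := wS.
have [_ zE] := circuit_del zC az; have zS := circuit_S zC.
move: zw; rewrite le_pairE => /andP[z1w z2w].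
have sub : omega.2 :\ a \subset omega.2 by apply: subsetDl.
apply: le_anti; rewrite (ljoin_le (bounds_sub sub xT)) /=.
rewrite [X in (X <= _)%O]wE; apply: ljoin_least => // [|t tw].
  exact: ljoin_le (bounds_sub sub xT).
have [->|ta] := eqVneq t a; last first.
  by apply: ljoin_bounds (bounds_sub sub xT) _ _; rewrite !inE ta.
have az1 : (a <= zeta.1)%O by case/S_P: zS => _ h _; apply: h.
apply: le_trans az1 _; rewrite -zE.
have [] := S_local (del_S a zS) (le_trans _ z1w); first by rewrite zE.
rewrite delE //= => _ ->; apply: ljoin_sub; last exact: setSD.
exact: bounds_sub sub xT.
Qed.

Lemma adjoin_S alpha a : alpha \in S_ -> a \in at_ -> (a <= alpha.1)%O ->
  (alpha.1, a |: alpha.2) \in S_.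
Proof.
move=> /S_P[Tat xT aE] a1 aa.
have wT : bounds alpha.1 (a |: alpha.2) by move=> t /setU1P[->|/xT].
have wat : a |: alpha.2 \subset at_ by rewrite subUset sub1set a1.
apply/S_P; split=> //=; apply: le_anti; rewrite [X in _ && X]ljoin_le // andbT.
by rewrite {1}aE ljoin_sub ?subsetUr.
Qed.

(** Two circuits z, z0 in a |: alpha.2 both contain a, which lies below the joins of
    z \ a and z0 \ a, hence by [independent_meet] below the join of their
    intersection. By minimality of z that intersection is all of z \ a, and
    symmetrically for z0. *)
Lemma adjoin_unicircular alpha a zeta : alpha \in I_ -> a \in at_ ->
  (a <= alpha.1)%O -> zeta \in circuits ->
  (zeta <= (alpha.1, a |: alpha.2))%O -> unicircular rho zeta (alpha.1, a |: alpha.2).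
Proof.
move=> aI a1 aa zC zw; have /I_P[/S_P[Tat xT aE] ra] := aI.
have wS := adjoin_S (I_S aI) a1 aa.
apply/unicircularP; split=> // z' z'C z'w.
have a_in (z : pairs) : z \in circuits -> (z <= (alpha.1, a |: alpha.2))%O ->
    [/\ a \in z.2, z.2 :\ a \subset alpha.2, (z.1 <= alpha.1)%O
      & (a <= ljoin alpha.1 (z.2 :\ a))%O].
  move=> zC0; rewrite le_pairE /= => /andP[z1 z2].
  have az : a \in z.2.
    apply/negPn/negP => az; have /negP[] := circuit_dependent zC0 aI.
    rewrite le_pairE z1 /=; apply/subsetP => t tz; have := subsetP z2 t tz.
    by case/setU1P => // ta; rewrite -ta tz in az.
  have sub : z.2 :\ a \subset alpha.2.
    by apply/subsetP => t /setD1P[ta /(subsetP z2)/setU1P[] // /eqP]; rewrite (negPf ta).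
  split=> //; have [_ dE] := circuit_del zC0 az.
  have zS := circuit_S zC0; have := del_S a zS => dS.
  have d1 : ((del z a).1 <= alpha.1)%O by rewrite dE.
  have [_] := S_local dS d1; rewrite dE delE //= => <-.
  by case/S_P: zS => _ h _; apply: h.
have sub_of (z z0 : pairs) : z \in circuits -> z0 \in circuits ->
    (z <= (alpha.1, a |: alpha.2))%O -> (z0 <= (alpha.1, a |: alpha.2))%O ->
    z.2 \subset z0.2.
  move=> zC1 zC2 /a_in-/(_ zC1)[az sz z1 jz] /a_in-/(_ zC2)[az0 sz0 z01 jz0].
  have jI := independent_meet xT Tat _ sz sz0 jz jz0.
  rewrite -aE in jI; have {jI} := jI ra.
  set A := _ :&: _ => jA; apply/subsetP => t tz; apply/negPn/negP => tz0.
  have subA : a |: A \subset z.2.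
    by rewrite subUset sub1set az; apply/subsetP => u; rewrite !inE => /andP[/andP[_ ->]].
  have /S_P[zat zT zE] := circuit_S zC1.
  have At : A \subset alpha.2 by apply: subset_trans sz; apply: subsetIl.
  have xA := bounds_sub At xT.
  have xaA : bounds alpha.1 (a |: A) by move=> u /setU1P[->//|]; apply: xA.
  have dS : (ljoin alpha.1 (a |: A), a |: A) \in S_.
    by apply: ljoin_S => //; apply: subset_trans subA zat.
  have /I_P[_ /=] : (ljoin alpha.1 (a |: A), a |: A) \in I_.
    apply: (circuit_sub zC1 dS).
      by apply: (S_le (x := alpha.1)) => //=; [exact: circuit_S | exact: ljoin_le].
    apply: contraNneq tz0 => e; move: tz; rewrite -e /= !inE => /orP[/eqP->//|].
    by case/andP => _ /andP[].
  have -> : ljoin alpha.1 (a |: A) = ljoin alpha.1 A.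
    apply: le_anti; rewrite [X in _ && X]ljoin_sub ?subsetUr // andbT.
    apply: ljoin_least => //; first exact: ljoin_le.
    by move=> u /setU1P[->//|]; apply: ljoin_bounds.
  rewrite (independent_sub xT Tat At) -?aE // cardsU1 !inE eqxx /=.
  by move/eqP; rewrite -[X in X == _]add0n eqn_add2r.
have e2 : z'.2 = zeta.2 by apply/eqP; rewrite eqEsubset !sub_of.
apply: (S_inj (x := alpha.1)) => //; try exact: circuit_S.
  by case: (a_in _ z'C z'w).
by case: (a_in _ zC zw).
Qed.

(** * The order on atoms, broken circuits, joins and meets in S *)

(** A numerical key for the order on atoms, so that signs can be computed by [isgn]. *)
Definition pos (a : P) : nat := #|[set b in at_ | r b a]|.

Lemma pos_le : {in at_ &, forall a b, (pos a <= pos b)%N = r a b}.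
Proof.
case: hr => rr ras rtr rtot a b a1 b1.
have memE x c : (c \in [set c in at_ | r c x]) = (c \in at_) && r c x.
  by rewrite [LHS]in_set.
have mono x y : x \in at_ -> y \in at_ -> r x y ->
    [set c in at_ | r c x] \subset [set c in at_ | r c y].
  move=> x1 y1 xy; apply/subsetP => c; rewrite !memE.
  by case/andP => c1 cx; rewrite c1 (rtr x c y x1 c1 y1 cx xy).
apply/idP/idP => [|/(mono _ _ a1 b1)/subset_leq_card//].
case/orP: (rtot a b a1 b1) => // ba card_le.
have e : [set c in at_ | r c b] = [set c in at_ | r c a].
  apply/eqP; rewrite eqEcard; apply/andP; split; [exact: mono | exact: card_le].
by have /setP/(_ a) := e; rewrite !memE a1 /= rr.
Qed.

Lemma pos_inj : {in at_ &, injective pos}.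
Proof.
case: hr => _ ras _ _ a b a1 b1 e; apply: ras => //.
by rewrite -!pos_le // e leqnn.
Qed.

Lemma sort_increasing s : uniq s -> {subset s <= at_} ->
  pairwise (fun a b => (pos a < pos b)%N) (sort r s).
Proof.
case: hr => rr ras rtr rtot us /allP s1.
have t1 : all (mem at_) (sort r s) by rewrite all_sort.
have := sort_sorted_in rtot s1; rewrite (sorted_pairwise_in rtr t1).
have: uniq (sort r s) by rewrite sort_uniq.
elim: (sort r s) t1 => //= a t IHt /andP[a1 t1] /andP[at_t ut] /andP[/allP ra rt].
rewrite IHt // andbT; apply/allP => b bt; have b1 := allP t1 b bt.
rewrite ltn_neqAle pos_le // ra // andbT; apply: contraNneq at_t => /pos_inj->//.
Qed.

Definition listing (A : {set P}) : seq P := sort r (enum A).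

Lemma mem_listing (A : {set P}) : listing A =i A.
Proof. by move=> a; rewrite mem_sort mem_enum. Qed.

Lemma listing_increasing (A : {set P}) : A \subset at_ ->
  pairwise (fun a b => (pos a < pos b)%N) (listing A).
Proof.
move=> /subsetP A1; apply: sort_increasing; rewrite ?enum_uniq // => a.
by rewrite mem_enum; apply: A1.
Qed.

Lemma perm_listing (A : {set P}) s : uniq s -> s =i A -> perm_eq s (listing A).
Proof.
by move=> us sA; rewrite perm_sym perm_sort uniq_perm ?enum_uniq // => a; rewrite mem_enum sA.
Qed.

Lemma uniq_pos s : uniq s -> {subset s <= at_} -> uniq (map pos s).
Proof. by move=> us s1; rewrite map_inj_in_uniq // => a b /s1 a1 /s1 b1; apply: pos_inj. Qed.

(** The sign of the sorting permutation counts the inversions of the concatenated list. *)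
Lemma sgn_listing (A B : {set P}) : A \subset at_ -> B \subset at_ ->
  A :&: B = set0 -> sgn r A B = isgn pos (listing A ++ listing B).
Proof.
move=> /subsetP A1 /subsetP B1 AB; apply: sgnE; apply: isgn_increasing.
apply: sort_increasing => [|a]; last first.
  by rewrite mem_cat !mem_listing => /orP[/A1|/B1].
rewrite cat_uniq !sort_uniq !enum_uniq andbT /=; apply/hasPn => a.
rewrite !mem_listing => aB; apply/negP => aA.
by have /setP/(_ a) := AB; rewrite !inE aA aB.
Qed.

Lemma nbcP beta : reflect
  (beta \in S_ /\ forall zeta a, zeta \in circuits -> a \in zeta.2 ->
    {in zeta.2, forall b, r a b} -> ~~ (del zeta a <= beta)%O)
  (beta \in nbc).
Proof.
rewrite [beta \in nbc]in_set; apply: (iffP andP) => -[bS nb]; split=> //.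
  move=> zeta a zC az amin; apply: (forall_inP nb (del zeta a)); rewrite in_set.
  apply/exists_inP; exists zeta => //; apply/exists_inP; exists a => //.
  by rewrite eqxx andbT; apply/forall_inP.
apply/forall_inP => gamma; rewrite [gamma \in _]in_set => /exists_inP[zeta zC].
by case/exists_inP => a az /andP[/forall_inP amin /eqP->]; apply: nb.
Qed.

Lemma set_min (A : {set P}) : A \subset at_ -> A != set0 ->
  exists2 a, a \in A & {in A, forall b, r a b}.
Proof.
move=> /subsetP A1 /set0Pn[a0 a0A].
case: (@arg_minnP _ a0 (fun a => a \in A) pos a0A) => a aA amin.
by exists a => // b bA; rewrite -pos_le ?amin ?A1.
Qed.

Lemma nbc_S beta : beta \in nbc -> beta \in S_. Proof. by case/nbcP. Qed.

(** A dependent element contains a circuit, hence the broken circuit of its least atom. *)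
Lemma nbc_I beta : beta \in nbc -> beta \in I_.
Proof.
case/nbcP => bS nb; apply: contraT => /(dependent_circuit bS)[zeta zC zb].
have zS := circuit_S zC.
have [a az amin] := set_min (S_atoms zS) (circuit_neq0 zC).
by have /negP[] := nb zeta a zC az amin; apply: le_trans (del_le a zS) zb.
Qed.

(** If alpha contains zeta \ a with a least in zeta, then a is below zeta.1, the top of
    zeta \ a, so it can be adjoined to alpha without changing the top. It is not in
    alpha already, since otherwise the independent alpha would contain zeta. *)
Lemma not_nbc alpha : alpha \in I_ -> alpha \notin nbc -> exists zeta a,
  [/\ a \in zeta.2, {in zeta.2, forall b, r a b}, a \in at_ /\ a \notin alpha.2
    & unicircular rho zeta (alpha.1, a |: alpha.2)].
Proof.
move=> aI; have aS := I_S aI; rewrite [alpha \in nbc]in_set aS /=.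
rewrite negb_forall_in => /exists_inP[gamma]; rewrite [gamma \in _]in_set negbK.
case/exists_inP => zeta zC /exists_inP[a az /andP[/forall_inP amin /eqP->]] da.
exists zeta, a; have zS := circuit_S zC; have a1 := subsetP (S_atoms zS) a az.
have [_ dE] := circuit_del zC az.
move: da; rewrite le_pairE dE => /andP[z1].
rewrite delE //= => z2.
have aal : (a <= alpha.1)%O by apply: le_trans z1; case/S_P: zS => _ h _; apply: h.
have z2' : zeta.2 \subset a |: alpha.2.
  apply/subsetP => t tz; have [->|ta] := eqVneq t a; rewrite !inE ?eqxx //.
  by rewrite (subsetP z2) ?orbT // !inE ta.
split=> //; first split=> //.
  apply: contra (circuit_dependent zC aI) => aal2; rewrite le_pairE z1 /=.
  by rewrite (setUidPr _) ?sub1set in z2'.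
by apply: adjoin_unicircular; rewrite // le_pairE z1.
Qed.

Lemma mem_lower alpha beta gamma :
  (gamma \in [set y in S_ | [forall t in [set alpha; beta], (y <= t)%O]]) =
  [&& gamma \in S_, (gamma <= alpha)%O & (gamma <= beta)%O].
Proof.
rewrite [LHS]in_set; congr (_ && _); apply/forall_inP/andP => [h | [ga gb] t].
  by split; apply: h; rewrite !inE eqxx ?orbT.
by case/set2P => ->.
Qed.

Lemma mem_upper alpha beta gamma :
  (gamma \in [set y in S_ | [forall t in [set alpha; beta], (t <= y)%O]]) =
  [&& gamma \in S_, (alpha <= gamma)%O & (beta <= gamma)%O].
Proof.
rewrite [LHS]in_set; congr (_ && _); apply/forall_inP/andP => [h | [ga gb] t].
  by split; apply: h; rewrite !inE eqxx ?orbT.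
by case/set2P => ->.
Qed.

Lemma meets_disjoint alpha beta : alpha \in S_ -> beta \in S_ ->
  alpha.2 :&: beta.2 = set0 -> meets S_ [set alpha; beta] = [set \bot%O].
Proof.
move=> aS bS ab.
have lb : [set y in S_ | [forall t in [set alpha; beta], (y <= t)%O]] = [set \bot%O].
  apply/setP => y; rewrite mem_lower [RHS]in_set1; apply/and3P/eqP => [[yS] | ->].
    rewrite !le_pairE => /andP[y1 ya] /andP[_ yb].
    have y0 : y.2 = set0 by apply/eqP; rewrite -subset0 -ab subsetI ya.
    by rewrite [y]surjective_pairing; case/S_P: yS => _ _ ->; rewrite y0 ljoin0.
  by rewrite !le0x; split=> //; apply/I_S/bot_I.
rewrite /meets lb; apply/setP => y; rewrite [LHS]in_set; apply: andb_idr.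
by move=> /set1P->; apply/forall_inP => t /set1P->; rewrite eqxx implybT.
Qed.

(** A common atom a gives the common lower bound (a, {a}). *)
Lemma disjoint_meets alpha beta : alpha \in S_ -> beta \in S_ ->
  meets S_ [set alpha; beta] = [set \bot%O] -> alpha.2 :&: beta.2 = set0.
Proof.
move=> aS bS mE; apply/eqP; apply: contraT => /set0Pn[a]; rewrite inE => /andP[aal ab].
have a1 := subsetP (S_atoms aS) a aal.
have /S_P[_ xa _] := aS; have /S_P[_ xb _] := bS.
have ga : bounds alpha.1 [set a] by move=> t /set1P->; apply: xa.
have jE : ljoin alpha.1 [set a] = a.
  apply: le_anti; rewrite [X in _ && X](ljoin_bounds ga) ?inE // andbT.
  by apply: ljoin_least; rewrite // ?xa // => t /set1P->.
have aP : (a, [set a]) \in [set y in S_ | [forall t in [set alpha; beta], (y <= t)%O]].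
  by rewrite mem_lower !le_pairE /= !sub1set aal ab xa // xb // -{1}jE ljoin_S ?sub1set.
have [m] := maximals_above aP; rewrite -[maximals _]/(meets _ _) mE => /set1P->.
by rewrite le_pairE /= => /andP[_ /subsetP/(_ a)]; rewrite !inE eqxx => /(_ isT).
Qed.

(** Minimal upper bounds are compared with the join of both atom sets taken below
    gamma.1, so at most one of them lies below x. *)
Lemma joins_below x alpha beta gamma : alpha \in S_ -> beta \in S_ ->
  gamma \in joins S_ [set alpha; beta] -> (gamma.1 <= x)%O ->
  [/\ (alpha.1 <= x)%O, (beta.1 <= x)%O
    & gamma = (ljoin x (alpha.2 :|: beta.2), alpha.2 :|: beta.2)].
Proof.
move=> aS bS; rewrite [gamma \in _]in_set mem_upper => /andP[/and3P[gS]].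
rewrite !le_pairE => /andP[a1 a2] /andP[b1 b2] /forall_inP gmin gx.
split; [exact: le_trans gx | exact: le_trans gx |].
have U1 : alpha.2 :|: beta.2 \subset at_ by rewrite subUset !S_atoms.
have gU : bounds gamma.1 (alpha.2 :|: beta.2).
  by move=> t /setUP[]; [case/S_P: aS => _ h _ /h | case/S_P: bS => _ h _ /h] => /le_trans->.
have dS := ljoin_S U1 gU; have dg := ljoin_le gU.
have := gmin (ljoin gamma.1 (alpha.2 :|: beta.2), alpha.2 :|: beta.2).
rewrite mem_upper dS ![(_ <= (_, _))%O](S_le (x := gamma.1)) ?subsetUl ?subsetUr //.
rewrite le_pairE /= dg subUset a2 b2 => /(_ isT) /eqP <- /=.
by rewrite (ljoin_local gx gU).
Qed.

Lemma joins_ljoin x alpha beta : alpha \in S_ -> beta \in S_ ->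
  (alpha.1 <= x)%O -> (beta.1 <= x)%O ->
  (ljoin x (alpha.2 :|: beta.2), alpha.2 :|: beta.2) \in joins S_ [set alpha; beta].
Proof.
move=> aS bS ax bx; have [xa _] := S_local aS ax; have [xb _] := S_local bS bx.
have U1 : alpha.2 :|: beta.2 \subset at_ by rewrite subUset !S_atoms.
have xU : bounds x (alpha.2 :|: beta.2) by move=> t /setUP[/xa|/xb].
have dS := ljoin_S U1 xU; have dx := ljoin_le xU.
rewrite [_ \in joins _ _]in_set mem_upper dS.
rewrite ![(_ <= (_, _))%O](S_le (x := x)) ?subsetUl ?subsetUr //=.
apply/forall_inP => y; rewrite mem_upper => /and3P[yS ay bY].
apply/implyP => yd; apply/eqP; apply: le_anti; rewrite yd /=.
move: ay bY; rewrite ![(_ <= y)%O]le_pairE => /andP[_ ay] /andP[_ bY].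
apply: (S_le (x := x)) => //=; last by rewrite subUset ay.
by move: yd; rewrite le_pairE => /andP[/le_trans->].
Qed.

(** * The flag of an nbc element *)

(** The flat x_b of the flag of beta: it grows as b decreases, from the rank one flat of
    the largest atom of beta up to beta.1. *)
Definition flat beta b : P := ljoin beta.1 [set c in beta.2 | r b c].

(** The step of the flag at which a appears, named by an element of beta. The default a is
    not reached when a is an atom below beta.1. *)
Definition label beta a : P :=
  odflt a [pick b in beta.2 | (a <= flat beta b)%O
    & [forall c in beta.2, (a <= flat beta c)%O ==> (pos c <= pos b)%N]].

Lemma upper_sub beta b : [set c in beta.2 | r b c] \subset beta.2.
Proof. by apply/subsetP => c; rewrite inE => /andP[]. Qed.

Lemma label_spec beta a : beta \in S_ -> a \in at_ -> (a <= beta.1)%O ->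
  [/\ label beta a \in beta.2, (a <= flat beta (label beta a))%O
    & forall b, b \in beta.2 -> (a <= flat beta b)%O -> (pos b <= pos (label beta a))%N].
Proof.
move=> bS a1 ab; have /S_P[Tat xT bE] := bS.
have T0 : beta.2 != set0.
  apply: contraTneq ab => T0; rewrite bE T0 ljoin0 lex0; apply: contraTneq a1 => ->.
  by rewrite inE (rank_bot hrho) andbF.
have [b0 b0T b0min] := set_min Tat T0.
have b0P : (b0 \in beta.2) && (a <= flat beta b0)%O.
  rewrite b0T /flat; suff -> : [set c in beta.2 | r b0 c] = beta.2 by rewrite -bE.
  by apply/setP => c; rewrite inE; apply: andb_idr; apply: b0min.
rewrite /label; case: pickP => [b /and3P[bT ab' /forall_inP bmax] | no].
  by split=> // c cT; apply/implyP/bmax.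
case: (@arg_maxnP _ b0 (fun b => (b \in beta.2) && (a <= flat beta b)%O) pos b0P).
move=> b /andP[bT ab'] bmax; have /negP[] := no b; rewrite bT ab' /=.
by apply/forall_inP => c cT; apply/implyP => ac; apply: bmax; rewrite cT.
Qed.

(** An element b of beta below the join of strictly larger elements of beta would
    contradict independence. *)
Lemma label_id beta b : beta \in I_ -> b \in beta.2 -> label beta b = b.
Proof.
move=> bI bT; have /I_P[bS bR] := bI; have /S_P[Tat xT bE] := bS.
have b1 := subsetP Tat b bT.
have [cT bc cmax] := label_spec bS b1 (xT b bT).
have c1 := subsetP Tat _ cT.
apply/eqP; apply: contraT => nbc.
have ub : bounds beta.1 [set c in beta.2 | r b c] := bounds_sub (upper_sub _ _) xT.
have rr : r b b by case: hr => rr _ _ _; apply: rr.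
have /cmax-/(_ bT) : (b <= flat beta b)%O by apply: (ljoin_bounds ub); rewrite inE bT.
rewrite pos_le // => rbc; rewrite bE in bR.
have /negP[] := independent_notin xT Tat bT bR; apply: le_trans bc _.
apply: ljoin_sub; first exact: bounds_sub (subsetDl _ _) xT.
apply/subsetP => c; rewrite inE => /andP[cbT rc]; rewrite !inE cbT andbT.
apply: contraNneq nbc => cb; rewrite cb in rc.
by case: hr => _ ras _ _; apply/eqP; apply: ras; rewrite ?rc.
Qed.

(** If a preceded b = label beta a, then a would depend on the set C of atoms of beta from
    b on, so some circuit in a |: C has a as its least atom, and its broken circuit
    lies in C, hence in beta. *)
Lemma label_le beta a : beta \in nbc -> a \in at_ -> (a <= beta.1)%O ->
  (pos (label beta a) <= pos a)%N.
Proof.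
move=> bN a1 ab; have bI := nbc_I bN; have bS := I_S bI; have /S_P[Tat xT bE] := bS.
have [] := label_spec bS a1 ab; set b := label beta a => bT ab' _.
have b1 := subsetP Tat b bT; rewrite leqNgt; apply/negP => lt_ab.
set C := [set c in beta.2 | r b c] in ab'.
have CT : C \subset beta.2 by apply: upper_sub.
have lt_aC c : c \in C -> (pos a < pos c)%N.
  rewrite inE => /andP[cT bc]; apply: leq_trans lt_ab _.
  by rewrite pos_le // (subsetP Tat).
have aC : a \notin C by apply/negP => /lt_aC; rewrite ltnn.
have CI := ljoin_I bI CT; have /I_P[CS CR] := CI.
have wS := adjoin_S CS a1 ab'.
have wI : (ljoin beta.1 C, a |: C) \notin I_.
  apply/negP => /I_P[_ /=]; rewrite cardsU1 aC [rho _]CR => /eqP.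
  by rewrite -[X in X == _]add0n eqn_add2r.
have [zeta zC zw] := dependent_circuit wS wI; have zS := circuit_S zC.
move: (zw); rewrite le_pairE => /andP[/= z1 z2].
have az : a \in zeta.2.
  apply: contraT => az; have /negP[] := circuit_dependent zC CI.
  rewrite le_pairE z1 /=; apply/subsetP => t tz; have /setU1P[ta|//] := subsetP z2 t tz.
  by rewrite -ta tz in az.
have amin : {in zeta.2, forall c, r a c}.
  move=> c /(subsetP z2)/setU1P[->|cC]; first by case: hr => rr _ _ _; apply: rr.
  by rewrite -pos_le ?(ltnW (lt_aC c cC)) // (subsetP Tat) // (subsetP CT).
have [_ dE] := circuit_del zC az.
have /nbcP[_ /(_ zeta a zC az amin)/negP[]] := bN.
rewrite le_pairE dE (le_trans z1 (ljoin_le (bounds_sub CT xT))) delE //=.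
apply: subset_trans CT; apply/subsetP => c /setD1P[ca /(subsetP z2)/setU1P[] //].
by move/eqP; rewrite (negPf ca).
Qed.

(** Remove the atom a with the least label. The others have larger labels, so they all lie
    in a flat of the flag not containing a, and a raises the rank of their join. *)
Lemma transversal_independent beta T : beta \in S_ -> T \subset at_ ->
  bounds beta.1 T -> {in T &, injective (label beta)} -> rho (ljoin beta.1 T) = #|T|.
Proof.
move=> bS; have /S_P[Bat xB _] := bS.
have [n] := ubnP #|T|; elim: n T => // n IHn T le_n Tat xT inj.
have [->|/set0Pn[a0 a0T]] := eqVneq T set0; first by rewrite ljoin0 (rank_bot hrho) cards0.
case: (@arg_minnP _ a0 (fun a => a \in T) (fun a => pos (label beta a)) a0T) => a aT amin.
have sub : T :\ a \subset T by apply: subsetDl.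
have [xD Dat] := (bounds_sub sub xT, subset_trans sub Tat).
have [a1 ax] := (subsetP Tat a aT, xT a aT).
have spec t : t \in T -> _ := fun tT => label_spec bS (subsetP Tat t tT) (xT t tT).
rewrite (cardsD1 a) aT add1n -(IHn (T :\ a)) //; last first.
  by move=> t u /(subsetP sub) tT /(subsetP sub) uT; apply: inj.
  by rewrite (cardsD1 a) aT in le_n.
rewrite -{1}(setD1K aT); apply: rank_ljoinU1_eq => //; apply/negP => aD.
have [D0|/set0Pn[b0 b0D]] := eqVneq (T :\ a) set0.
  rewrite D0 ljoin0 lex0 in aD; move: a1; rewrite (eqP aD).
  by rewrite inE (rank_bot hrho) andbF.
case: (@arg_minnP _ b0 (fun a' => a' \in T :\ a) (fun a => pos (label beta a)) b0D) => b bD bmin.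
have bT := subsetP sub b bD; have [lbT bb _] := spec b bT.
have [laT _ amax] := spec a aT.
have : (a <= flat beta (label beta b))%O.
  apply: le_trans aD _; apply: ljoin_least => //.
    by apply: ljoin_le; apply: bounds_sub (upper_sub _ _) xB.
  move=> t tD; have tT := subsetP sub t tD; have [ltT tt _] := spec t tT.
  apply: le_trans tt _; apply: ljoin_sub; first exact: bounds_sub (upper_sub _ _) xB.
  have := bmin t tD; rewrite pos_le ?(subsetP Bat) // => rbt.
  apply/subsetP => c; rewrite !inE => /andP[cB rtc]; rewrite cB.
  case: hr => _ _ rtr _; apply: rtr rbt rtc; exact: (subsetP Bat).
move/(amax _ lbT) => le_ba; have le_ab := amin b bT.
have /pos_inj : pos (label beta a) = pos (label beta b) by apply/eqP; rewrite eqn_leq le_ab.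
rewrite !(subsetP Bat) // => /(_ isT isT) /(inj a b aT bT) ab.
by move: bD; rewrite ab !inE eqxx.
Qed.

(** * Flag forms on words *)

Definition letters (w : seq pairs) : seq P := flatten [seq listing alpha.2 | alpha <- w].

(** The form F_beta on words. For a word of disjoint independent elements it reads off
    whether the listed atoms appear at different steps of the flag, and in which order. *)
Definition flag_form beta (w : seq pairs) : rat :=
  (all (fun alpha => (alpha.1 <= beta.1)%O) w)%:R *
  isgn (pos \o label beta) (letters w).

Lemma letters_cat u v : letters (u ++ v) = letters u ++ letters v.
Proof. by rewrite /letters map_cat flatten_cat. Qed.

Lemma letters_cons alpha v : letters (alpha :: v) = listing alpha.2 ++ letters v.
Proof. by []. Qed.

Lemma uniq_listing (A : {set P}) : uniq (listing A).
Proof. by rewrite sort_uniq enum_uniq. Qed.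

Lemma size_listing (A : {set P}) : size (listing A) = #|A|.
Proof. by rewrite size_sort cardE. Qed.

Lemma flag_form_bot beta u v : flag_form beta (u ++ \bot%O :: v) = flag_form beta (u ++ v).
Proof.
rewrite /flag_form !all_cat /= le0x !letters_cat letters_cons.
suff -> : listing (\bot%O : pairs).2 = [::] by [].
by apply: size0nil; rewrite size_listing cards0.
Qed.

Lemma flag_form_swap beta u v alpha gamma :
  flag_form beta (u ++ alpha :: gamma :: v) =
  (-1) ^+ (#|alpha.2| * #|gamma.2|) * flag_form beta (u ++ gamma :: alpha :: v).
Proof.
rewrite /flag_form !all_cat /= (andbCA (gamma.1 <= _)%O) !letters_cat !letters_cons.
by rewrite isgn_swap !size_listing; ring.
Qed.

Lemma flag_form_meet beta u v alpha gamma : alpha.2 :&: gamma.2 != set0 ->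
  flag_form beta (u ++ alpha :: gamma :: v) = 0.
Proof.
case/set0Pn => a; rewrite inE => /andP[aa ag]; rewrite /flag_form.
set s := letters _; suff : isgn (pos \o label beta) s == 0 by move/eqP->; rewrite mulr0.
apply: contraT; rewrite isgn_neq0 => /map_uniq; rewrite /s letters_cat !letters_cons.
rewrite cat_uniq => /and3P[_ _]; rewrite cat_uniq => /and3P[_ /hasPn/(_ a) h _].
by move: h; rewrite mem_cat !mem_listing ag aa => /(_ isT).
Qed.

(** The contrapositive of [transversal_independent], inside a longer word. *)
Lemma isgn_dependent beta T u v : beta \in S_ -> T \subset at_ -> bounds beta.1 T ->
  rho (ljoin beta.1 T) != #|T| -> isgn (pos \o label beta) (u ++ listing T ++ v) = 0.
Proof.
move=> bS Tat xT dep; apply/eqP; apply: contraT; rewrite isgn_neq0 !map_cat.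
rewrite cat_uniq => /and3P[_ _]; rewrite cat_uniq => /and3P[uT _ _].
case/eqP: dep; apply: transversal_independent => // a b aT bT lab.
by apply: (uniq_map_inj uT); rewrite ?mem_listing //= lab.
Qed.

(** Below the height beta.1 the sum has at most the one term given by the join of both
    atom sets. Merging the two lists costs the sign of their shuffle; if the join is not
    in I, then the labels repeat and both sides vanish. *)
Lemma flag_form_join beta u v alpha gamma : beta \in S_ -> alpha \in I_ -> gamma \in I_ ->
  alpha.2 :&: gamma.2 = set0 ->
  flag_form beta (u ++ alpha :: gamma :: v) = sgn r alpha.2 gamma.2 *
    \sum_(delta in joins S_ [set alpha; gamma] :&: I_) flag_form beta (u ++ delta :: v).
Proof.
move=> bS aI gI ag; have [aS gS] := (I_S aI, I_S gI).
have [Aat Gat] := (S_atoms aS, S_atoms gS).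
have Uat : alpha.2 :|: gamma.2 \subset at_ by rewrite subUset Aat.
have zero delta : ~~ (delta.1 <= beta.1)%O -> flag_form beta (u ++ delta :: v) = 0.
  by move=> h; rewrite /flag_form all_cat /= (negPf h) andbF mul0r.
have [xa|xa] := boolP (alpha.1 <= beta.1)%O; last first.
  rewrite big1 ?mulr0 ?[LHS]/flag_form ?all_cat /= ?(negPf xa) ?andbF ?mul0r //.
  move=> delta /setIP[dJ _]; apply: zero; apply: contra xa => dx.
  by have [] := joins_below aS gS dJ dx.
have [xg|xg] := boolP (gamma.1 <= beta.1)%O; last first.
  rewrite big1 ?mulr0 ?[LHS]/flag_form ?all_cat /= ?(negPf xg) ?andbF ?mul0r //.
  move=> delta /setIP[dJ _]; apply: zero; apply: contra xg => dx.
  by have [] := joins_below aS gS dJ dx.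
set U := alpha.2 :|: gamma.2 in Uat *; pose delta := (ljoin beta.1 U, U).
have xU : bounds beta.1 U.
  by move=> t /setUP[]; [case: (S_local aS xa) => h _ /h | case: (S_local gS xg) => h _ /h].
have -> : flag_form beta (u ++ alpha :: gamma :: v) =
    sgn r alpha.2 gamma.2 * flag_form beta (u ++ delta :: v).
  have tE : perm_eq (listing alpha.2 ++ listing gamma.2) (listing U).
    apply: perm_listing => [|a]; last by rewrite mem_cat !mem_listing inE.
    rewrite cat_uniq !uniq_listing andbT /=; apply/hasPn => a; rewrite !mem_listing => aG.
    by apply/negP => aA; have /setP/(_ a) := ag; rewrite !inE aA aG.
  have kt : uniq (map pos (listing alpha.2 ++ listing gamma.2)).
    apply: uniq_pos => [|a]; first by rewrite (perm_uniq tE) uniq_listing.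
    by rewrite (perm_mem tE) mem_listing; apply: (subsetP Uat).
  rewrite /flag_form !all_cat /= xa xg (ljoin_le xU) /= !letters_cat !letters_cons /=.
  rewrite (catA (listing _)).
  rewrite (isgn_reorder _ _ _ kt tE) -sgn_listing // (isgn_increasing (listing_increasing Uat)).
  ring.
congr (_ * _); have [dI|dI] := boolP (delta \in I_).
  rewrite (bigD1 delta) /=; last by rewrite inE dI joins_ljoin.
  rewrite big1 ?addr0 // => d' /andP[/setIP[dJ _] d'd]; apply: zero.
  by apply: contra d'd => dx; have [_ _ ->] := joins_below aS gS dJ dx.
rewrite big1 => [|d' /setIP[dJ d'I]]; last first.
  apply: zero; apply: contra dI => dx; have [_ _ dE] := joins_below aS gS dJ dx.
  by rewrite /delta -dE.
rewrite /flag_form letters_cat letters_cons isgn_dependent ?mulr0 //.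
apply: contra dI => /eqP dE; apply/I_P; split=> //; exact: ljoin_S.
Qed.

Lemma listing1 (a : P) : listing [set a] = [:: a].
Proof. by rewrite /listing enum_set1. Qed.

(** Putting the removed atom a back in front rewrites each term of a circuit relation over
    the common remainder W \ {a, b}, which makes the terms for a and b comparable. *)
Lemma circuit_term (l : P -> nat) (W : {set P}) a b s t :
  W \subset at_ -> a \in W -> b \in W -> a != b ->
  sgn r [set a] (W :\ a) * isgn l (s ++ listing (W :\ a) ++ t) =
  isgn pos [:: a, b & listing (W :\: [set a; b])] *
  isgn l (s ++ (b :: listing (W :\: [set a; b])) ++ t).
Proof.
move=> Wat aW bW ab; set R := listing (W :\: [set a; b]).
have Dat : W :\ a \subset at_ := subset_trans (subsetDl _ _) Wat.
have tE : perm_eq (listing (W :\ a)) (b :: R).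
  rewrite perm_sym; apply: perm_listing => [|c].
    by rewrite /= uniq_listing andbT mem_listing in_setD set22.
  rewrite inE mem_listing !inE; case: (eqVneq c b) => [->|cb] /=; last by rewrite orbF.
  by rewrite eq_sym ab bW.
have kt : uniq (map pos (listing (W :\ a))).
  by apply: uniq_pos => [|c]; rewrite ?uniq_listing // mem_listing; apply: (subsetP Dat).
have kt' : uniq (map pos (b :: R)) by rewrite -(perm_uniq (perm_map pos tE)).
have k1 := isgn_increasing (listing_increasing Dat).
rewrite sgn_listing ?sub1set ?(subsetP Wat) //; last first.
  by apply/setP => c; rewrite !inE; case: eqP.
rewrite listing1 (isgn_reorder l _ _ kt tE) k1 mul1r.
rewrite -[_ ++ listing _]/([:: a] ++ listing (W :\ a)) -[listing (W :\ a)]cats0.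
rewrite (isgn_reorder pos _ _ kt tE) k1 mul1r cats0 /=.
by rewrite mulrACA isgn_sq // mul1r.
Qed.

(** If some term a is nonzero, the labels are distinct on omega \ a, while they are not
    on the dependent set zeta; so a shares its label with exactly one b in zeta.
    The terms of a and b differ by the transposition of a and b, and the other terms
    contain both. *)
Lemma flag_form_circuit beta u v zeta omega :
  beta \in S_ -> unicircular rho zeta omega ->
  \sum_(a in zeta.2) sgn r [set a] (del omega a).2 *
    flag_form beta (u ++ del omega a :: v) = 0.
Proof.
move=> bS uni; have /unicircularP[wS zC zw _] := uni; have zS := circuit_S zC.
move: (zw); rewrite le_pairE => /andP[z1 z2].
pose l := pos \o label beta.
pose c : rat := (all (fun alpha => (alpha.1 <= beta.1)%O) u && ((omega.1 <= beta.1)%O &&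
   all (fun alpha => (alpha.1 <= beta.1)%O) v))%:R.
pose g a := sgn r [set a] (omega.2 :\ a) *
  isgn l (letters u ++ listing (omega.2 :\ a) ++ letters v).
have termE a : a \in zeta.2 ->
    sgn r [set a] (del omega a).2 * flag_form beta (u ++ del omega a :: v) = c * g a.
  move=> az; have [_ ->] := unicircular_del uni az.
  by rewrite /flag_form all_cat /= letters_cat letters_cons /g /c /=; ring.
rewrite (eq_bigr _ termE) -mulr_sumr /c.
have [wx|wx] := boolP (omega.1 <= beta.1)%O; last by rewrite andbF mul0r.
suff -> : \sum_(a in zeta.2) g a = 0 by rewrite mulr0.
have [xW _] := S_local wS wx; have Wat := S_atoms wS.
have [a /andP[az ga]|g0] := pickP (fun a => (a \in zeta.2) && (g a != 0)); last first.
  by rewrite big1 // => a az; have := g0 a; rewrite az /= => /negbT/negPn/eqP.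
have inj t : t \in zeta.2 -> g t != 0 -> {in omega.2 :\ t &, injective l}.
  move=> _; rewrite mulf_eq0 negb_or isgn_neq0 !map_cat cat_uniq => /andP[_ /and3P[_ _]].
  rewrite cat_uniq => /and3P[uT _ _] x y xT yT.
  by apply: (uniq_map_inj uT); rewrite mem_listing.
(* zeta is dependent, so labels repeat on it; off a they do not. *)
have [b bz [ab lab]] : exists2 b, b \in zeta.2 & a != b /\ l a = l b.
  have /existsP[b /and3P[bz ab /eqP lab]] : [exists b, [&& b \in zeta.2, a != b & l a == l b]];
    last by exists b.
  apply: contraT => /existsPn nb; have [xz zE] := S_local zS (le_trans z1 wx).
  have /negP[] : zeta \notin I_ by case/circuitP: zC.
  apply/I_P; split=> //.
  rewrite zE; apply: transversal_independent => //; first exact: S_atoms.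
  move=> x y xz' yz' /(congr1 pos); rewrite -!/(l _) => lxy.
  have nb' t : t \in zeta.2 -> l a = l t -> a = t.
    move=> tz lat; apply/eqP; apply: contraT => neq_at.
    by have := nb t; rewrite tz neq_at lat eqxx.
  have [ax|ax] := eqVneq a x; first by rewrite -ax in lxy *; have := nb' y yz' lxy.
  have [ay|ay] := eqVneq a y.
    by rewrite -ay in lxy *; have := nb' x xz' (esym lxy).
  by apply: (inj a az ga); rewrite // in_setD1 ?(subsetP z2) // eq_sym ?ax ?ay.
have [aW bW] := (subsetP z2 a az, subsetP z2 b bz).
rewrite (bigD1 a) //= (bigD1 b) /=; last by rewrite bz eq_sym.
rewrite big1 ?addr0 => [|t /andP[/andP[tz ta] tb]]; last first.
  apply/eqP; apply: contraT => /(inj t tz)/(_ a b) e; case/eqP: ab; apply: e => //.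
    by rewrite !inE eq_sym ta.
  by rewrite !inE eq_sym tb.
rewrite /g (circuit_term l _ _ Wat aW bW ab) (circuit_term l _ _ Wat bW aW) 1?eq_sym //.
rewrite [[set b; a]]setUC; set R := listing _.
have -> : isgn l (letters u ++ (b :: R) ++ letters v) =
    isgn l (letters u ++ (a :: R) ++ letters v).
  by apply: isgn_map; rewrite !map_cat /= -/(l a) -/(l b) lab.
have := isgn_swap pos [::] [:: a] [:: b] R; rewrite /= expr1 => ->.
by ring.
Qed.

Lemma flag_form_diag beta : beta \in I_ -> flag_form beta [:: beta] = 1.
Proof.
move=> bI; rewrite /flag_form /= lexx mul1r /letters /= cats0.
rewrite -[RHS](isgn_increasing (listing_increasing (S_atoms (I_S bI)))).
apply: isgn_map; apply/eq_in_map => a; rewrite mem_listing => aT /=.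
by rewrite label_id.
Qed.

(** The summand is positive and decreasing in the position, so that the weight strictly
    grows both when an atom is replaced by a smaller one and when an atom is added. *)
Definition weight alpha : nat := (\sum_(a in alpha.2) (#|at_|.+1 - pos a))%N.

Lemma pos_max a : (pos a <= #|at_|)%N.
Proof. by apply: subset_leq_card; rewrite setIdE subsetIl. Qed.

(** A nonzero value makes the labelling an injection of gamma into beta that never raises
    positions. So weight gamma <= weight beta, and equality forces the labelling to fix
    every atom of gamma and to reach all of beta. *)
Lemma flag_form_triangular beta gamma : beta \in nbc -> gamma \in S_ ->
  flag_form beta [:: gamma] != 0 -> (weight beta <= weight gamma)%N -> gamma = beta.
Proof.
move=> bN gS; have bS := nbc_S bN; rewrite /flag_form /= andbT /letters /= cats0.
have [gx|] := boolP (gamma.1 <= beta.1)%O; last by rewrite mul0r eqxx.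
rewrite mul1r isgn_neq0 => uT le_w; apply: (S_inj (x := beta.1)) => //.
have [xT _] := S_local gS gx; have Tat := S_atoms gS.
have inj : {in gamma.2 &, injective (label beta)}.
  move=> a b aT bT lab; by apply: (uniq_map_inj uT); rewrite ?mem_listing //= lab.
have labB a : a \in gamma.2 -> label beta a \in beta.2.
  by move=> aT; case: (label_spec bS (subsetP Tat a aT) (xT a aT)).
have leif a : a \in gamma.2 -> (#|at_|.+1 - pos a <= #|at_|.+1 - pos (label beta a)
     ?= iff (label beta a == a))%N.
  move=> aT; have a1 := subsetP Tat a aT; have le_la := label_le bN a1 (xT a aT).
  split; first exact: leq_sub2l.
  rewrite eqn_sub2lE ?leqW ?pos_max //; apply/eqP/eqP => [e|-> //].
  by apply: pos_inj => //; apply: (subsetP (S_atoms bS)); apply: labB.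
have [le_sum eq_sum] := leqif_sum leif.
have imB : label beta @: gamma.2 \subset beta.2.
  by apply/subsetP => _ /imsetP[a aT ->]; apply: labB.
have := le_w; rewrite /weight (big_setID (label beta @: gamma.2)) /= (setIidPr imB).
rewrite big_imset //=; set rest := (\sum_(i in _ :\: _) _)%N => le_w'.
have rest0 : rest = 0%N.
  apply/eqP; rewrite -leqn0 -(leq_add2l (\sum_(i in gamma.2) (#|at_|.+1 - pos (label beta i)))%N).
  by rewrite addn0; apply: leq_trans le_w' _.
have eqB : beta.2 = label beta @: gamma.2.
  apply/eqP; rewrite eqEsubset imB andbT -setD_eq0; apply/eqP/setP => b; rewrite in_set0.
  apply/negP => bD; move/eqP: rest0; rewrite sum_nat_eq0 => /forall_inP/(_ b bD).
  by rewrite subn_eq0 ltnNge pos_max.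
have idT : {in gamma.2, forall a, label beta a = a}.
  move=> a aT; apply/eqP; move: a aT; apply/forall_inP; rewrite -eq_sum eqn_leq le_sum /=.
  by rewrite rest0 addn0 in le_w'.
by rewrite eqB -[LHS]imset_id; apply: eq_in_imset => a /idT.
Qed.

(** * Spanning *)

Local Notation cls := (@os_class _ P rho r).
Local Notation e_ := (e_ rho).
Local Notation nbc_index := {beta : pairs | beta \in nbc}.

Lemma clsD u v : cls (u + v) = cls u + cls v.
Proof. exact: qclassD. Qed.

Lemma clsZ c u : cls (c *: u) = c *: cls u.
Proof. exact: qclassZ. Qed.

Lemma clsM u v : cls (u * v) = cls u * cls v.
Proof. exact: qclassM. Qed.

Lemma cls0 : cls 0 = 0.
Proof. by rewrite -(scale0r 0) clsZ scale0r. Qed.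

Lemma cls_sum (J : finType) (p : pred J) (F : J -> E_ rho) :
  cls (\sum_(j | p j) F j) = \sum_(j | p j) cls (F j).
Proof. exact: (big_morph _ clsD cls0). Qed.

Lemma cls_rel u : os_rel r u -> cls u = 0.
Proof.
by move=> ru; apply/eqP; rewrite qclass_eq0; apply/in_ideal_gen => K _; apply.
Qed.

Definition spanned (v : orlik_solomon rho r) : Prop :=
  exists c : nbc_index -> rat, v = \sum_j c j *: cls (e_ (val j)).

Lemma spanned0 : spanned 0.
Proof. by exists (fun=> 0); rewrite big1 // => j _; rewrite scale0r. Qed.

Lemma spannedD v w : spanned v -> spanned w -> spanned (v + w).
Proof.
move=> [b ->] [c ->]; exists (fun j => b j + c j).
by rewrite -big_split; apply: eq_bigr => j _; rewrite scalerDl.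
Qed.

Lemma spannedZ c v : spanned v -> spanned (c *: v).
Proof.
move=> [b ->]; exists (fun j => c * b j).
by rewrite scaler_sumr; apply: eq_bigr => j _; rewrite scalerA.
Qed.

Lemma spanned_sum (J : finType) (p : pred J) (F : J -> orlik_solomon rho r) :
  (forall j, p j -> spanned (F j)) -> spanned (\sum_(j | p j) F j).
Proof. by move=> hF; apply: big_ind => //; [exact: spanned0 | exact: spannedD]. Qed.

Lemma spanned_nbc beta : beta \in nbc -> spanned (cls (e_ beta)).
Proof.
move=> bN; pose j0 : nbc_index := Sub beta bN; exists (fun j => (j == j0)%:R).
rewrite (bigD1 j0) //= eqxx scale1r big1 ?addr0 // => j /negPf->.
by rewrite scale0r.
Qed.

Lemma sgn_neq0 (A B : {set P}) : sgn r A B != 0.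
Proof. by rewrite signr_eq0. Qed.

(** Rewriting by the circuit relation replaces an atom b by a smaller a, so the sum of
    positions is the induction measure. *)
Lemma spanned_I alpha : alpha \in I_ -> spanned (cls (e_ alpha)).
Proof.
have [n] := ubnP (\sum_(a in alpha.2) pos a)%N; elim: n alpha => // n IHn alpha le_n aI.
have [/spanned_nbc//|aN] := boolP (alpha \in nbc).
have [zeta [a [az amin [a1 aal] uni]]] := not_nbc aI aN.
have [_ delaE] := unicircular_del uni az.
have dela : del (alpha.1, a |: alpha.2) a = alpha.
  by rewrite delaE /= setU1K // [RHS]surjective_pairing.
(* Solve the circuit relation for the term of a, which is alpha itself. *)
have := cls_rel (OSCircuit r uni); rewrite (bigD1 a) //= dela clsD clsZ.
move/eqP; rewrite addr_eq0 => /eqP e.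
have -> : cls (e_ alpha) =
    (sgn r [set a] alpha.2)^-1 *: (sgn r [set a] alpha.2 *: cls (e_ alpha)).
  by rewrite scalerA mulVf ?sgn_neq0 // scale1r.
rewrite e -scaleN1r; do 2!apply: spannedZ.
rewrite cls_sum; apply: spanned_sum => b /andP[bz ba]; rewrite clsZ; apply: spannedZ.
have [dI dE] := unicircular_del uni bz; apply: IHn => //; rewrite dE /=.
have [wS zC zw _] := unicircularP _ _ uni.
have zw2 : zeta.2 \subset a |: alpha.2 by move: zw; rewrite le_pairE => /andP[].
have bal : b \in alpha.2 by have /setU1P[/eqP|//] := subsetP zw2 b bz; rewrite (negPf ba).
rewrite -ltnS; apply: leq_trans le_n; rewrite ltnS.
have sumU : (\sum_(c in a |: alpha.2) pos c = pos a + \sum_(c in alpha.2) pos c)%N.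
  by rewrite big_setU1.
have sumD : (\sum_(c in a |: alpha.2) pos c = pos b + \sum_(c in (a |: alpha.2) :\ b) pos c)%N.
  by rewrite (big_setD1 b) ?inE ?bal ?orbT.
have lt_ab : (pos a < pos b)%N.
  have b1 := subsetP (S_atoms (I_S aI)) b bal.
  rewrite ltn_neqAle pos_le // amin // andbT.
  by apply: contra ba => /eqP/pos_inj->.
by rewrite -(ltn_add2l (pos b)) -sumD sumU ltn_add2r.
Qed.

(** The meet and join relations turn the product of two generators into single generators. *)
Lemma spanned_mul alpha v : alpha \in I_ -> spanned v -> spanned (cls (e_ alpha) * v).
Proof.
move=> aI [c ->]; rewrite mulr_sumr; apply: spanned_sum => j _.
have -> : cls (e_ alpha) * (c j *: cls (e_ (val j))) =
    c j *: (cls (e_ alpha) * cls (e_ (val j))).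
  by rewrite [RHS](@quot_scalerAr _ _ (@os_rel _ P rho r)).
apply: spannedZ; have := valP j; move: (val j) => beta bN; have bI := nbc_I bN.
have [->|a0] := eqVneq alpha \bot%O.
  by rewrite {1}/Defs.e_ eqxx mul1r; apply: spanned_I.
have [->|b0] := eqVneq beta \bot%O.
  by rewrite [e_ \bot%O]/Defs.e_ eqxx mulr1; apply: spanned_I.
have aI0 : alpha \in I_ :\ \bot%O by apply/setD1P.
have bI0 : beta \in I_ :\ \bot%O by apply/setD1P.
rewrite -clsM; have [mE|/eqP mE] := eqVneq (meets S_ [set alpha; beta]) [set \bot%O].
  have := cls_rel (OSJoin r aI0 bI0 mE); rewrite -scaleN1r !clsD !clsZ => /eqP.
  rewrite addr_eq0 => /eqP->; rewrite -scaleN1r; do 3!apply: spannedZ.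
  by rewrite cls_sum; apply: spanned_sum => g /setIP[_ gI]; apply: spanned_I.
by rewrite (cls_rel (OSMeet r aI0 bI0 mE)); apply: spanned0.
Qed.

Lemma spanned_all v : spanned v.
Proof.
elim/(@qclass_ind _ _ (@os_rel _ P rho r)): v => x.
elim/(@qclass_ind _ _ (gc_rel (@os_deg _ P rho))): x => y.
rewrite -/(cls _); elim/free_alg_ind: y => [|y z hy hz|c y hy|s].
- have -> : qclass (gc_rel (@os_deg _ P rho)) 0 = 0 by apply/eqP; rewrite qclass_eq0 rpred0.
  by rewrite cls0; apply: spanned0.
- by rewrite qclassD clsD; apply: spannedD.
- by rewrite qclassZ clsZ; apply: spannedZ.
elim: s => [|i s IHs].
  rewrite /word big_nil qclass1; have := spanned_I bot_I.
  by rewrite /Defs.e_ eqxx.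
rewrite -cat1s word_cat qclassM clsM word1.
have iI := valP i; have /setD1P[i0 iI'] := iI.
have -> : qclass (gc_rel (@os_deg _ P rho)) (free_gen i) = e_ (val i).
  by rewrite /Defs.e_ (negPf i0) valK.
exact: spanned_mul.
Qed.

(** * Linear independence *)

Local Notation qc := (qclass (gc_rel (@os_deg _ P rho))).

(** A word representing e_alpha: the empty word for the minimum, as e_0 = 1. *)
Definition word_of alpha : seq (os_index rho) :=
  if insub alpha is Some i then [:: i] else [::].

Lemma qc_sum (J : finType) (p : pred J) (F : J -> free_alg (os_index rho)) :
  qc (\sum_(j | p j) F j) = \sum_(j | p j) qc (F j).
Proof.
apply: (big_morph _ (@qclassD _ _ _)); apply/eqP; rewrite qclass_eq0.
exact: rpred0.
Qed.

Lemma qc_word_of alpha : alpha \in I_ -> qc (word (word_of alpha)) = e_ alpha.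
Proof.
move=> aI; rewrite /word_of /Defs.e_; case: insubP => [i /setD1P[a0 _] _ | ].
  by rewrite (negPf a0) word1.
rewrite in_setD1 aI andbT negbK => ->.
by rewrite /word big_nil qclass1.
Qed.

Definition index_val beta (s : seq (os_index rho)) : rat := flag_form beta (map val s).

Lemma flag_form_word_of beta u v alpha : alpha \in I_ ->
  flag_form beta (u ++ map val (word_of alpha) ++ v) = flag_form beta (u ++ alpha :: v).
Proof.
move=> aI; rewrite /word_of; case: insubP => [i _ <- //|].
by rewrite in_setD1 aI andbT negbK => /eqP->; rewrite flag_form_bot.
Qed.

(** Each kind of relation is represented by the obvious combination of words, and
    [flag_form_meet], [flag_form_join] and [flag_form_circuit] hold with
    arbitrary words on both sides. *)
Lemma kills_os_rel beta g : beta \in S_ -> os_rel r g ->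
  exists2 y, qc y = g & kills word (extend (index_val beta)) y.
Proof.
move=> bS; case=> [a c /setD1P[_ aI] /setD1P[_ cI] mN
                  | a c /setD1P[_ aI] /setD1P[_ cI] mE | zeta omega uni].
- exists (word (word_of a ++ word_of c)).
    by rewrite word_cat qclassM !qc_word_of.
  move=> s t; rewrite -!word_cat /= extend_word /index_val !map_cat -!catA.
  rewrite flag_form_word_of // -cat_rcons flag_form_word_of // cat_rcons flag_form_meet //.
  by apply/eqP => ac; apply: mN; apply: meets_disjoint; rewrite ?I_S.
- exists (word (word_of a ++ word_of c) +
      \sum_(delta in joins S_ [set a; c] :&: I_) (- sgn r a.2 c.2) *: word (word_of delta)).
    rewrite word_cat qclassD qclassM qc_sum.
    rewrite !qc_word_of //.
    congr (_ + _).
    rewrite scaler_sumr -sumrN; apply: eq_bigr => delta /setIP[_ dI].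
    by rewrite qclassZ qc_word_of // scaleNr.
  move=> s t; rewrite mulrDr mulrDl linearD.
  rewrite [X in _ + X](kills_sum word_cat).
  rewrite -!word_cat /=.
  rewrite extend_word.
  rewrite /index_val !map_cat -!catA.
  rewrite flag_form_word_of // -cat_rcons flag_form_word_of // cat_rcons.
  rewrite (flag_form_join _ _ bS aI cI (disjoint_meets (I_S aI) (I_S cI) mE)).
  rewrite mulr_sumr -big_split big1 // => delta /setIP[_ dI] /=.
  by rewrite extend_word !map_cat flag_form_word_of // mulNr subrr.
exists (\sum_(a in zeta.2) sgn r [set a] (del omega a).2 *: word (word_of (del omega a))).
  rewrite qc_sum; apply: eq_bigr => a az; have [dI _] := unicircular_del uni az.
  by rewrite qclassZ qc_word_of.
move=> s t; rewrite (kills_sum word_cat) -[RHS](flag_form_circuit (map val s) (map val t) bS uni).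
apply: eq_bigr => a az; have [dI _] := unicircular_del uni az.
by rewrite /= extend_word /index_val !map_cat flag_form_word_of.
Qed.

Lemma flag_form_relation beta (c : nbc_index -> rat) : beta \in S_ ->
  \sum_j c j *: cls (e_ (val j)) = 0 -> \sum_j c j * flag_form beta [:: val j] = 0.
Proof.
move=> bS c0; pose y := \sum_j c j *: word (word_of (val j)).
have jI (j : nbc_index) : val j \in I_ := nbc_I (valP j).
have qy : qc y \in ideal_gen (@os_rel _ P rho r).
  have : cls (qc y) = 0.
    rewrite /y qc_sum cls_sum -[RHS]c0.
    by apply: eq_bigr => j _; rewrite qclassZ clsZ qc_word_of.
  by move/eqP; rewrite qclass_eq0.
have hsym s t i j : index_val beta (s ++ i :: j :: t) =
    (-1) ^+ (os_deg i * os_deg j) * index_val beta (s ++ j :: i :: t).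
  by rewrite /index_val !map_cat /= flag_form_swap.
have y0 := extend_ideal0 hsym (fun g => @kills_os_rel beta g bS) qy.
rewrite -[RHS]y0 /y linear_sum; apply: eq_bigr => j _.
rewrite linearZ /= extend_word /index_val.
by have := flag_form_word_of beta [::] [::] (jI j); rewrite cats0 /= => ->.
Qed.

(** Evaluate a relation with F_beta, where beta has minimal weight among the indices with
    a nonzero coefficient: by triangularity only the coefficient of beta survives. *)
Lemma nbc_independent (c : nbc_index -> rat) :
  \sum_j c j *: cls (e_ (val j)) = 0 -> forall j, c j = 0.
Proof.
move=> c0 j0; apply/eqP; apply: contraT => cj0.
case: (@arg_minnP _ j0 (fun j => c j != 0) (fun j => weight (val j)) cj0) => j cj jmin.
have jI := nbc_I (valP j); have := flag_form_relation (I_S jI) c0.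
rewrite (bigD1 j) //= flag_form_diag // mulr1 big1 ?addr0 => [e|k kj].
  by rewrite e eqxx in cj.
have [->|ck] := eqVneq (c k) 0; first by rewrite mul0r.
apply/eqP; rewrite mulf_eq0 (negPf ck); apply: contraT => wk.
have := flag_form_triangular (valP j) (nbc_S (valP k)) wk (jmin k ck) => /val_inj kj'.
by rewrite kj' eqxx in kj.
Qed.

End Independence.

Theorem theorem3p3p2 (d : Order.disp_t) (P : finBPOrderType d)
    (rho : P -> nat) (r : rel P)
    (hP : locally_geometric P)
    (hrho : rank_function [set: P] rho)
    (hr : linear_order_on (atoms [set: P] rho) r) :
  is_basis (fun beta : {beta : P * {set P} | beta \in nbc rho r} =>
              os_class r (e_ rho (val beta))).
Proof.
split; first exact: (nbc_independent hP hrho hr).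
exact: (spanned_all hP hrho hr).
Qed.
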